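(* Let $k\ge1$ be a fixed integer, suppose $p=p_n$ satisfies $p/\log n\to\beta\in(0,\infty)$ as $n\to\infty$, and suppose $\mu=N(0,1)$. Then $$\frac{T_{n,k}}{p}\longrightarrow\lambda_{k,\beta}\qquad\text{in probability as }n\to\infty,$$ where $\lambda_{k,\beta}$ is the unique solution in $(1,\infty)$ of the equation $\lambda-\log\lambda-1=\frac{2k}{\beta}$.
   Context: $X=X_n=(\xi_{ij})_{1\le i\le p,\,1\le j\le n}\in\mathbb R^{p\times n}$ has i.i.d. entries with law $\mu$. For $S\subset[n]=\{1,\dots,n\}$, $X_{[S]}$ is the submatrix formed by the columns indexed by $S$, and $$T_{n,k}:=\max_{S\subset[n],\,|S|=k}\lambda_{\max}\big(X_{[S]}^\top X_{[S]}\big).$$ *)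

(* Defs.v *)
From HB Require Import structures.
From mathcomp Require Import all_boot all_order all_algebra.
From mathcomp Require Import all_classical all_reals all_analysis.

Set Implicit Arguments.
Unset Strict Implicit.
Unset Printing Implicit Defensive.

Import Order.TTheory GRing.Theory Num.Theory.
Import numFieldNormedType.Exports.

Local Open Scope classical_set_scope.
Local Open Scope ring_scope.

Definition mutually_independent (R : realType) (d : measure_display)
    (Omega : measurableType d) (P : probability Omega R) (I : finType)
    (X : I -> {RV P >-> R}) : Prop :=
  forall (J : {set I}) (B : I -> set R), (forall i, measurable (B i)) ->
    P (\bigcap_(i in [set` J]) (X i @^-1` B i)) =
    (\prod_(i in J) P (X i @^-1` B i))%E.

(* Laws are compared on measurable sets only: the value of a measure on a
   non-measurable set is unspecified. *)
Definition has_law (R : realType) (d : measure_display)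
    (Omega : measurableType d) (P : probability Omega R)
    (X : {RV P >-> R}) (mu : set R -> \bar R) : Prop :=
  forall B : set R, measurable B -> distribution P X B = mu B.

Definition iid_with_law (R : realType) (d : measure_display)
    (Omega : measurableType d) (P : probability Omega R) (I : finType)
    (X : I -> {RV P >-> R}) (mu : set R -> \bar R) : Prop :=
  mutually_independent X /\ (forall i, has_law (X i) mu).

(* The variables may live on different probability spaces, which is harmless
   as the limit is a constant. The values of P n are meaningful only on
   measurable events, so this notion is intended for measurable Y n. *)
Definition cvg_in_probability (R : realType) (d : nat -> measure_display)
    (Omega : forall n, measurableType (d n))
    (P : forall n, probability (Omega n) R)
    (Y : forall n, Omega n -> R) (c : R) : Prop :=
  forall eps : R, 0 < eps ->
    P n [set w | eps < `|Y n w - c|] @[n --> \oo] --> 0%E.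

(* The supremum is a maximum as soon as A has a real eigenvalue, in particular
   for A symmetric of positive size. *)
Definition lambda_max (R : realType) (m : nat) (A : 'M[R]_m) : R :=
  sup [set a | eigenvalue A a].

Definition cols (R : Type) (p n : nat) (X : 'M[R]_(p, n)) (S : {set 'I_n}) :
    'M[R]_(p, #|S|) :=
  colsub (enum_val : 'I_#|S| -> 'I_n) X.

(* Supremum of a finite set, nonempty exactly when k <= n; for n < k the value
   is the dummy sup set0 = 0, which is irrelevant for k fixed, n --> +oo. *)
Definition max_gram_eigenvalue (R : realType) (p n k : nat)
    (X : 'M[R]_(p, n)) : R :=
  sup [set lambda_max ((cols X S)^T *m cols X S)
      | S in [set S : {set 'I_n} | #|S| = k]].

(* Main.v *)
Require Import Defs.
From HB Require Import structures.
From mathcomp Require Import all_boot all_order all_algebra.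
From mathcomp Require Import all_classical all_reals all_analysis.
From mathcomp Require Import measurable_realfun.
From mathcomp Require Import ring lra.

Set Implicit Arguments.
Unset Strict Implicit.
Unset Printing Implicit Defensive.

Import Order.TTheory GRing.Theory Num.Theory.
Import numFieldNormedType.Exports.

Local Open Scope classical_set_scope.
Local Open Scope ring_scope.

(** Let g(x) = x - ln x - 1. By the variational characterization of the largest
    eigenvalue, T is the maximum of |X u|^2 over the unit vectors u supported
    on at most k coordinates, and for a fixed u the variable |X u|^2 is
    chi-squared with p degrees of freedom: P(|X u|^2 >= p y) is about
    exp(- p g(y) / 2) for y > 1. As there are about n^k supports and p is about
    beta ln n, the threshold for the maximum is g(y) = 2 k / beta. Making this
    rigorous has two halves of very different nature.

    Upper bound ([max_eig_upper_tail]). The unit vectors on a given support are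
    replaced by the points of a fixed finite grid, at the price of a factor
    1 - 4 theta on the maximum ([grid_net]), and the union bound is combined
    with the Chernoff bound. The same grids write T as a countable supremum,
    which gives its measurability.

    Lower bound ([max_eig_lower_tail]). Fix l < lambda, so that
    g(l) < 2 k / beta. For a k-set F of columns, let L_F be the likelihood ratio
    that gives variance l, instead of 1, to the normalized sum Y_F of the
    columns of F in every row. It has expectation 1, and under the tilted law
    |Y_F|^2 is close to p l. If T < p l (1 - delta), then all the variables
    L_F 1(|Y_F|^2 >= p l (1 - delta)) vanish, and one would like to contradict
    this by Chebyshev's inequality applied to their average. The plain second
    moment is too large for big l: two overlapping k-sets F and G contribute
    E L_F L_G, which is dominated by the event that the sum over the r common
    columns is far larger than what is typical even under the tilted law. Hence
    L_F is also truncated to the event that, for every non-empty J included in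
    F, the sum over J does not exceed its typical size under the tilted law,
    which is governed by the variance l_r = 1 + (l - 1) r / k for r = |J|. After
    this truncation a pair with overlap r contributes about exp(p g(l_r) / 2)
    ([overlap_bound]), whereas a proportion of at most about (k / n)^r of the
    pairs has this overlap ([sum_overlap_le]). By concavity of ln,
    g(l_r) <= (r / k) g(l), so that exp(p g(l_r) / 2) n^(-r) tends to 0 for all
    r >= 1 exactly because g(l) < 2 k / beta; the pairs with r = 0 give the
    square of the first moment.

    All expectations needed are those of exponentials of quadratic forms in
    independent Gaussian variables. They are computed by integrating out one
    variable at a time: a factor exp(t (z + a x)^2 / 2) becomes a constant times
    exp(t' z^2 / 2) with 1/t' = 1/t - a^2 ([EX_gaussian_sum]). Indicators are
    never integrated; they are bounded by exponentials beforehand. *)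

(** * Gaussian integrals in one variable *)
Section normal_integral.
Context {R : realType}.
Local Notation leb := (@lebesgue_measure R).

Lemma integral_normal_prob (m s : R) (f : R -> \bar R) :
    measurable_fun setT f -> (forall x, (0 <= f x)%E) ->
  (\int[normal_prob m s]_x f x = \int[leb]_x (f x * (normal_pdf m s x)%:E))%E.
Proof.
move=> mf f0.
have dom := normal_prob_dominates m s.
rewrite -(Radon_Nikodym_SigmaFinite.change_of_variables dom)//.
apply: ae_eq_integral => //.
- apply: emeasurable_funM => //.
  exact: measurable_int (Radon_Nikodym_SigmaFinite.f_integrable dom).
- apply: emeasurable_funM => //; apply/measurable_EFinP.
  by have := measurable_normal_pdf m s.
- apply: ae_eqe_mul2l; apply: integral_ae_eq => //.
  + exact: (Radon_Nikodym_SigmaFinite.f_integrable dom).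
  + apply/measurable_EFinP; exact: measurable_normal_pdf.
  + by move=> E _ mE; rewrite -Radon_Nikodym_SigmaFinite.f_integral.
Qed.

Lemma expR_ln_half (v : R) : 0 < v -> expR (ln v / 2) = Num.sqrt v.
Proof.
move=> v0; by rewrite expRM lnK ?posrE// powR12_sqrt// ltW.
Qed.

(** Completing the square: the integrand times the standard normal density is
    a constant multiple of a normal density with variance 1 / (1 - t a^2). *)
Lemma integral_normal_expR_sqr (t z a : R) : t * a ^+ 2 < 1 ->
  (\int[normal_prob 0 1]_y (expR (t / 2 * (z + a * y) ^+ 2))%:E =
   (expR (- ln (1 - t * a ^+ 2) / 2) *
    expR (t / (1 - t * a ^+ 2) / 2 * z ^+ 2))%:E)%E.
Proof.
move=> ta; pose v := 1 - t * a ^+ 2.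
have v0 : 0 < v by rewrite subr_gt0.
have m1 : measurable_fun [set: R] (fun y => expR (t / 2 * (z + a * y) ^+ 2)).
  apply: measurableT_comp => //; apply: measurable_funM => //.
  by apply: measurable_funX; apply: measurable_funD => //; apply: measurable_funM.
rewrite integral_normal_prob; last 2 first.
- exact/measurable_EFinP.
- by move=> x; rewrite lee_fin expR_ge0.
pose s := Num.sqrt v^-1; pose m := t * a * z / v.
have s0 : s != 0 by rewrite gt_eqF// sqrtr_gt0 invr_gt0.
have s2 : s ^+ 2 = v^-1 by rewrite sqr_sqrtr// invr_ge0 ltW.
rewrite -/v.
have E y : (expR (t / 2 * (z + a * y) ^+ 2) * normal_pdf 0 1 y =
    expR (- ln v / 2) * expR (t / v / 2 * z ^+ 2) * normal_pdf m s y)%R.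
  rewrite !normal_pdfE// ?oner_eq0// /normal_peak /normal_fun.
  have -> : (Num.sqrt (s ^+ 2 * pi *+ 2))^-1 =
     expR (ln v / 2) * (Num.sqrt (1 ^+ 2 * pi *+ 2))^-1 :> R.
    rewrite s2 expr1n mul1r -mulrnAr sqrtrM ?invr_ge0 ?(ltW v0)//.
    by rewrite sqrtrV ?(ltW v0)// invfM invrK (expR_ln_half v0).
  have -> : expR (- ln v / 2) = (expR (ln v / 2))^-1 by rewrite mulNr expRN.
  set A := Num.sqrt _; set e := expR (ln v / 2).
  have e0 : e != 0 by rewrite gt_eqF// expR_gt0.
  rewrite mulrCA -expRD.
  transitivity (A^-1 * (expR (t / v / 2 * z ^+ 2) * expR (- (y - m) ^+ 2 / (s ^+ 2 *+ 2)))).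
    rewrite -expRD; congr (_ * expR _); rewrite s2 /m.
    rewrite subr0 expr1n (_ : v^-1 *+ 2 = 2 / v); last by rewrite mulr_natl.
    have : v != 0 by rewrite gt_eqF.
    by rewrite /v => {}v0; field.
  by move: (A^-1) => B; field; exact: e0.
transitivity (\int[leb]_y ((expR (- ln v / 2) * expR (t / v / 2 * z ^+ 2))%:E *
    (normal_pdf m s y)%:E))%E.
  by apply: eq_integral => y _; rewrite -!EFinM E.
rewrite ge0_integralZl//.
- by rewrite integral_normal_pdf mule1.
- by apply/measurable_EFinP; exact: measurable_normal_pdf.
- by move=> y _; rewrite lee_fin normal_pdf_ge0.
Qed.
End normal_integral.

(** * Integrating out one coordinate of an independent family *)
Definition upd (T : eqType) (S : Type) (x : T -> S) (i : T) (y : S) : T -> S :=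
  fun j => if j == i then y else x j.

(** Measurability for the product sigma-algebra on [I -> R], expressed as
    stability under substitution of measurable maps. *)
Definition jointly_measurable (R : realType) (I : Type) (F : (I -> R) -> R) :=
  forall (d : measure_display) (T : measurableType d) (g : I -> T -> R),
    (forall i, measurable_fun setT (g i)) ->
    measurable_fun setT (fun t => F (g ^~ t)).

Section independent_coordinate.
Context {R : realType} (d : measure_display) (T : measurableType d).
Context (P : probability T R) (I : finType) (X : I -> {RV P >-> R}).
Hypothesis indepX : mutually_independent X.
Variable i : I.

(** The pi-system generating the sigma-algebra of the coordinates other than
    [i]; [T0] is the probability space with that smaller sigma-algebra. *)
Let G : set (set T) := [set A | exists B : I -> set R,
  (forall j, measurable (B j)) /\
  A = \bigcap_(j in [set` ([set~ i])%SET]) (X j @^-1` B j)].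

Let T0 := g_sigma_algebraType G.

Let G_measurable A : G A -> measurable A.
Proof.
move=> [B [mB ->]]; apply: fin_bigcap_measurable => // j _.
by rewrite -[X in measurable X]setTI; exact: measurable_funPT.
Qed.

Let sG_measurable A : <<s G >> A -> measurable A.
Proof. exact: (smallest_sub (@sigma_algebra_measurable _ T) G_measurable). Qed.

Let id0 : T -> T0 := id.

Let measurable_id0 : measurable_fun setT id0.
Proof. by move=> _ A mA; rewrite setTI; exact: sG_measurable. Qed.

HB.instance Definition _ := isMeasurableFun.Build _ _ _ _ id0 measurable_id0.

Let G_setI : setI_closed G.
Proof.
move=> _ _ [A [mA ->]] [B [mB ->]]; exists (fun j => A j `&` B j); split.
  by move=> j; exact: measurableI.
rewrite eqEsubset; split=> [w [Aw Bw] j jn|w ABw]; first by split; [exact: Aw|exact: Bw].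
by split=> j jn; have [] := ABw j jn.
Qed.

Let GT : G setT.
Proof.
by exists (fun=> setT); split=> //; rewrite bigcapT.
Qed.

Let indep_G A B : G A -> measurable B ->
  P (A `&` X i @^-1` B) = (P (X i @^-1` B) * P A)%E.
Proof.
move=> [C [mC ->]] mB.
pose C' j := if j == i then B else C j.
have mC' j : measurable (C' j) by rewrite /C'; case: ifP.
have -> : \bigcap_(j in [set` ([set~ i])%SET]) (X j @^-1` C j) `&` X i @^-1` B =
    \bigcap_(j in [set` [set: I]%SET]) (X j @^-1` C' j).
  rewrite eqEsubset; split=> [w [Cw Bw] j _|w Cw].
    rewrite /C' /=; case: eqP => [->//|/eqP ji]; apply: Cw.
    by rewrite /= !inE.
  split=> [j|].
    rewrite /= !inE => ji; have := Cw j; rewrite /C' (negbTE ji); apply.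
    by rewrite /= inE.
  by have := Cw i; rewrite /C' eqxx; apply; rewrite /= inE.
rewrite !indepX// (bigD1 i)//= /C' eqxx; congr (_ * _)%E.
apply: eq_big => [j|j ji]; first by rewrite !inE andTb.
by case/andP: ji => _ /negbTE ->.
Qed.

Let indep_sG A B : <<s G >> A -> measurable B ->
  P (A `&` X i @^-1` B) = (P A * P (X i @^-1` B))%E.
Proof.
move=> sA mB.
have mXB : measurable (X i @^-1` B).
  by rewrite -[X in measurable X]setTI; exact: measurable_funPT.
have fP : P (X i @^-1` B) \is a fin_num by exact: fin_num_measure.
have p0 : 0 <= fine (P (X i @^-1` B)) by exact: fine_ge0.
transitivity (mscale (NngNum p0) P A); last by rewrite /mscale /= fineK// muleC.
apply: (@g_sigma_algebra_measure_unique _ R T G G_measurable (fun=> setT)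
  (fun=> GT) _ (mrestr P mXB) (mscale (NngNum p0) P) G_setI _ _ A sA).
- by rewrite bigcup_const.
- move=> A' GA'.
  change (P (A' `&` X i @^-1` B) = ((fine (P (X i @^-1` B)))%:E * P A')%E).
  by rewrite fineK//; exact: indep_G.
- move=> _; change (P (setT `&` X i @^-1` B) < +oo)%E.
  by rewrite setTI -ge0_fin_numE.
Qed.

(** The pair formed by all the other coordinates, remembered as the sample point
    itself, and by the coordinate [i]. *)
Let pair0 : T -> T0 * R := fun w => (w, X i w).

Let measurable_pair0 : measurable_fun setT pair0.
Proof. by apply: measurable_fun_pair. Qed.

HB.instance Definition _ := isMeasurableFun.Build _ _ _ _ pair0 measurable_pair0.

(** The other coordinates and [X i] are independent, so the joint law of [pair0]
    is a product measure and Tonelli's theorem applies. *)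
Lemma expectation_integrate_coordinate (F : (I -> R) -> R) :
    jointly_measurable F -> (forall x, 0 <= F x) ->
  (\int[P]_w (F (fun j => X j w))%:E =
   \int[P]_w \int[distribution P (X i)]_y (F (upd (fun j => X j w) i y))%:E)%E.
Proof.
move=> mF F0.
pose H (z : T0 * R) := F (upd (fun j => X j z.1) i z.2).
have mH : measurable_fun setT H.
  apply: (mF _ (T0 * R)%type (fun j z => upd (fun j => X j z.1) i z.2 j)) => j.
  rewrite /upd; case: eqP => [_|/eqP ji]; first exact: measurable_snd.
  suff mXj : @measurable_fun _ _ T0 R setT (X j).
    exact: (measurableT_comp mXj (@measurable_fst _ _ T0 R)).
  move=> _ B mB.
  rewrite setTI; apply: sub_sigma_algebra.
  exists (fun k => if k == j then B else setT); split.
    by move=> k; case: ifP.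
  rewrite eqEsubset; split=> [w Bw k _ /=|w Bw].
    by case: eqP => [->|].
  by have := Bw j; rewrite /= eqxx; apply; rewrite !inE.
have H0 z : (0 <= (H z)%:E)%E by rewrite lee_fin; exact: F0.
have mEH : measurable_fun setT (fun z => (H z)%:E).
  by apply/measurable_EFinP; exact: mH.
have prodE A : measurable A ->
    (distribution P id0 \x distribution P (X i))%E A = distribution P pair0 A.
  apply: product_measure_unique => {}A B mA mB.
  rewrite -indep_sG//.
transitivity (\int[distribution P pair0]_z (H z)%:E)%E.
  rewrite ge0_integral_distribution//; apply: eq_integral => w _ /=.
  congr (F _)%:E; apply/funext => j; rewrite /upd /pair0 /=.
  by case: eqP => [->|].
rewrite -(eq_measure_integral _ (fun A mA _ => prodE A mA)).
rewrite fubini_tonelli1//.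
rewrite ge0_integral_distribution//.
- exact: (measurable_fun_fubini_tonelli_F _ mEH H0).
- by move=> w; apply: integral_ge0.
Qed.
End independent_coordinate.

(** * Expectations of exponentials of Gaussian quadratic forms *)
Section jointly_measurable_theory.
Context {R : realType} (I : eqType).
Implicit Types F G : (I -> R) -> R.

Lemma jointly_measurable_cst (c : R) : @jointly_measurable R I (fun=> c).
Proof. by move=> d T g mg; exact: measurable_cst. Qed.

Lemma jointly_measurable_coord (i : I) : @jointly_measurable R I (fun x => x i).
Proof. by move=> d T g; exact. Qed.

Lemma jointly_measurableD F G : jointly_measurable F -> jointly_measurable G ->
  jointly_measurable (fun x => F x + G x).
Proof.
by move=> mF mG d T g mg; apply: measurable_funD; [exact: mF|exact: mG].
Qed.

Lemma jointly_measurableM F G : jointly_measurable F -> jointly_measurable G ->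
  jointly_measurable (fun x => F x * G x).
Proof.
by move=> mF mG d T g mg; apply: measurable_funM; [exact: mF|exact: mG].
Qed.

Lemma jointly_measurable_expR F : jointly_measurable F ->
  jointly_measurable (fun x => expR (F x)).
Proof. by move=> mF d T g mg; apply: measurableT_comp => //; exact: mF. Qed.

Lemma jointly_measurable_sum (J : Type) (s : seq J) (p : pred J)
    (F : J -> (I -> R) -> R) : (forall j, jointly_measurable (F j)) ->
  jointly_measurable (fun x => \sum_(j <- s | p j) F j x).
Proof.
move=> mF; elim: s => [|j s IH].
  by under eq_fun do rewrite big_nil; exact: jointly_measurable_cst.
under eq_fun do rewrite big_cons; case: (p j); last exact: IH.
exact: (jointly_measurableD (mF j) IH).
Qed.

Lemma jointly_measurable_prod (J : Type) (s : seq J) (p : pred J)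
    (F : J -> (I -> R) -> R) : (forall j, jointly_measurable (F j)) ->
  jointly_measurable (fun x => \prod_(j <- s | p j) F j x).
Proof.
move=> mF; elim: s => [|j s IH].
  by under eq_fun do rewrite big_nil; exact: jointly_measurable_cst.
under eq_fun do rewrite big_cons; case: (p j); last exact: IH.
exact: (jointly_measurableM (mF j) IH).
Qed.

Lemma jointly_measurable_sqr F : jointly_measurable F ->
  jointly_measurable (fun x => F x ^+ 2).
Proof. by move=> mF; exact: jointly_measurableM. Qed.

End jointly_measurable_theory.

Ltac jmeas := repeat first
  [ assumption | apply: jointly_measurable_cst | apply: jointly_measurable_coord
  | apply: jointly_measurable_expR | apply: jointly_measurable_sqr
  | apply: jointly_measurable_sum => ?
  | apply: jointly_measurable_prod => ? | apply: jointly_measurableM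
  | apply: jointly_measurableD ].

Definition ignores (T : eqType) (S V : Type) (F : (T -> S) -> V) (i : T) :=
  forall x y, F (upd x i y) = F x.

Lemma measurable_upd (R : realType) (I : eqType) (F : (I -> R) -> R) x i :
  jointly_measurable F -> measurable_fun setT (fun y => F (upd x i y)).
Proof.
move=> mF; apply: (mF _ R (fun j y => upd x i y j)) => j.
by rewrite /upd; case: eqP => _; [exact: measurable_id|exact: measurable_cst].
Qed.

Section gaussian_expectation.
Context {R : realType} (d : measure_display) (T : measurableType d).
Context (P : probability T R) (I : finType) (X : I -> {RV P >-> R}).
Hypothesis iidX : iid_with_law X (normal_prob 0 1).

Definition EX (F : (I -> R) -> R) : \bar R := \int[P]_w (F (fun j => X j w))%:E.

Lemma measurable_EX F : jointly_measurable F ->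
  measurable_fun setT (fun w => F (fun j => X j w)).
Proof. by move=> mF; apply: (mF _ _ (fun j => X j)) => j; exact: measurable_funPT. Qed.

Lemma EX_Zl (c : R) F : 0 <= c -> jointly_measurable F -> (forall x, 0 <= F x) ->
  EX (fun x => c * F x) = (c%:E * EX F)%E.
Proof.
move=> c0 mF F0; rewrite /EX.
under eq_integral do rewrite EFinM.
rewrite ge0_integralZl_EFin//.
- by move=> w _; rewrite lee_fin.
- by apply/measurable_EFinP; exact: measurable_EX.
Qed.

Lemma integral_coordinate (i : I) (f : R -> R) :
    measurable_fun setT f -> (forall y, 0 <= f y) ->
  (\int[distribution P (X i)]_y (f y)%:E = \int[normal_prob 0 1]_y (f y)%:E)%E.
Proof.
move=> mf f0.
pose N : {measure set (measurableTypeR R) -> \bar R} := normal_prob 0 1.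
pose f' : measurableTypeR R -> \bar R := fun y => (f y)%:E.
have mid : @measurable_fun _ _ R (measurableTypeR R) setT id.
  by move=> _ A mA; rewrite setTI.
have mf' : measurable_fun setT f' by apply/measurable_EFinP.
transitivity (\int[pushforward (distribution P (X i)) (id : R -> measurableTypeR R)]_y f' y)%E.
  by rewrite [RHS]ge0_integral_pushforward// => y _; rewrite lee_fin.
apply: (eq_measure_integral N) => A mA _.
exact: (proj2 iidX).
Qed.

(** The result has the shape of the integrand, with [t] replaced by
    [t / (1 - t * a ^+ 2)]: this is what allows the iteration below. *)
Lemma EX_gaussian1 (t a : R) (i : I) (z rest : (I -> R) -> R) :
    t * a ^+ 2 < 1 -> jointly_measurable z -> jointly_measurable rest ->
    (forall x, 0 <= rest x) -> ignores z i -> ignores rest i ->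
  EX (fun x => expR (t / 2 * (z x + a * x i) ^+ 2) * rest x) =
  ((expR (- ln (1 - t * a ^+ 2) / 2))%:E *
   EX (fun x => expR (t / (1 - t * a ^+ 2) / 2 * z x ^+ 2) * rest x)%R)%E.
Proof.
move=> ta mz mr r0 zi ri.
rewrite -EX_Zl ?expR_ge0//; [|by jmeas|by move=> x; rewrite mulr_ge0 ?expR_ge0].
set F := (fun x => expR (t / 2 * (z x + a * x i) ^+ 2) * rest x).
have mF : jointly_measurable F by jmeas.
have F0 x : 0 <= F x by rewrite mulr_ge0 ?expR_ge0.
transitivity (\int[P]_w \int[distribution P (X i)]_y
    (F (upd (fun j => X j w) i y))%:E)%E.
  exact: (expectation_integrate_coordinate (proj1 iidX) i mF F0).
apply: eq_integral => w _; rewrite integral_coordinate//; last first.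
  exact: measurable_upd.
set x := (fun j => X j w).
transitivity (\int[normal_prob 0 1]_y
    ((rest x)%:E * (expR (t / 2 * (z x + a * y) ^+ 2))%:E))%E.
  apply: eq_integral => y _; rewrite -EFinM; congr (_%:E).
  by rewrite /F zi ri /upd eqxx mulrC.
rewrite ge0_integralZl//.
  by rewrite integral_normal_expR_sqr// -EFinM mulrC mulrA.
- apply/measurable_EFinP; apply: measurableT_comp => //.
  apply: measurable_funM => //; apply: measurable_funX.
  by apply: measurable_funD => //; apply: measurable_funM.
- by rewrite lee_fin.
Qed.

(** The substitution t -> t / (1 - t a^2) subtracts a^2 from 1/t, so iterating it
    only depends on the sum of the squares of the coefficients. *)
Lemma EX_gaussian_sum (s : seq I) (t : R) (a : I -> R) (z rest : (I -> R) -> R) :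
    uniq s -> t * (\sum_(i <- s) a i ^+ 2) < 1 ->
    jointly_measurable z -> jointly_measurable rest ->
    (forall x, 0 <= rest x) -> {in s, forall i, ignores z i} ->
    {in s, forall i, ignores rest i} ->
  let v := \sum_(i <- s) a i ^+ 2 in
  EX (fun x => expR (t / 2 * (z x + \sum_(i <- s) a i * x i) ^+ 2) * rest x) =
  ((expR (- ln (1 - t * v) / 2))%:E *
   EX (fun x => expR (t / (1 - t * v) / 2 * z x ^+ 2) * rest x)%R)%E.
Proof.
move=> + + + mr r0; elim: s z => [|i s IH] z us tv mz zs rs v.
  rewrite /v big_nil mulr0 subr0 ln1 oppr0 mul0r expR0 divr1 mul1e.
  by under eq_fun do rewrite big_nil addr0.
move: us => /= /andP[is_ us].
pose v' := \sum_(j <- s) a j ^+ 2.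
have vE : v = a i ^+ 2 + v' by rewrite /v big_cons.
have v'0 : 0 <= v' by apply: sumr_ge0 => j _; exact: sqr_ge0.
have tv' : t * v' < 1.
  have [t0|t0] := leP t 0; first by rewrite (le_lt_trans _ ltr01)// mulr_le0_ge0.
  by apply: le_lt_trans tv; rewrite ler_pM2l// -/v vE lerDr sqr_ge0.
under eq_fun do rewrite big_cons addrA.
have mz' : jointly_measurable (fun x => z x + a i * x i) by jmeas.
have zs' : {in s, forall j, ignores (fun x => z x + a i * x i) j}.
  move=> j js x y; rewrite zs ?inE ?js ?orbT//; congr (_ + _ * _).
  by rewrite /upd; case: eqP => // ij; rewrite ij js in is_.
have rs' : {in s, forall j, ignores rest j}.
  by move=> j js; apply: rs; rewrite inE js orbT.
rewrite (IH _ us tv' mz' zs' rs').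
rewrite -/v'.
have w0 : 0 < 1 - t * v' by rewrite subr_gt0.
have w1 : 0 < 1 - t * v by rewrite subr_gt0.
have E : 1 - t / (1 - t * v') * a i ^+ 2 = (1 - t * v) / (1 - t * v').
  by rewrite vE; field; rewrite gt_eqF.
rewrite EX_gaussian1//; last 3 first.
- by rewrite -subr_gt0 E divr_gt0.
- by apply: zs; rewrite inE eqxx.
- by apply: rs; rewrite inE eqxx.
have E' : t / (1 - t * v') / (1 - t / (1 - t * v') * a i ^+ 2) = t / (1 - t * v).
  by rewrite E; field; rewrite !gt_eqF.
rewrite muleA -EFinM -expRD E' E ln_div ?posrE//.
by congr ((expR _)%:E * _)%E; field.
Qed.

(** Functions of disjoint rows are handled one row at a time: assuming the
    factorization against an arbitrary factor [rest] that does not see the row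
    makes the induction immediate, and replaces the independence of the rows as
    random vectors. *)
Lemma EX_prod_rows (J : eqType) (s : seq J) (row : J -> pred I)
    (H : J -> (I -> R) -> R) (h : R) :
    uniq s -> 0 <= h ->
    (forall j x, 0 <= H j x) -> (forall j, jointly_measurable (H j)) ->
    (forall j k i, j != k -> row j i -> ignores (H k) i) ->
    (forall j rest, jointly_measurable rest -> (forall x, 0 <= rest x) ->
      (forall i, row j i -> ignores rest i) ->
      EX (fun x => H j x * rest x) = (h%:E * EX rest)%E) ->
  EX (fun x => \prod_(j <- s) H j x) = (h ^+ size s)%:E.
Proof.
move=> + h0 H0 mH Hi HE; elim: s => [_|j s IH /= /andP[js us]].
  rewrite /EX; under eq_integral do rewrite big_nil.
  by rewrite integral_cst// [X in (1 * X)%E](probability_setT P) mule1.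
under eq_fun do rewrite big_cons.
rewrite HE ?IH//; last 3 first.
- by jmeas.
- by move=> x; apply: prodr_ge0 => k _.
- move=> i ji x y; rewrite !big_seq; apply: eq_bigr => k ks; apply: (Hi j) => //.
  by apply: contraNneq js => ->.
by rewrite exprS EFinM.
Qed.
End gaussian_expectation.

(** * Column sums of a Gaussian matrix *)
Section gaussian_matrix.
Context {R : realType} (p n : nat) (d : measure_display) (T : measurableType d).
Context (P : probability T R) (X : 'I_p * 'I_n -> {RV P >-> R}).
Hypothesis iidX : iid_with_law X (normal_prob 0 1).
Local Notation EX := (EX X).
Implicit Types (x : 'I_p * 'I_n -> R) (u : 'I_n -> R) (r : 'I_p) (S F G : {set 'I_n}).

Definition quad u x : R := \sum_(r < p) (\sum_(c < n) u c * x (r, c)) ^+ 2.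
Definition colsum S r x : R := \sum_(c in S) x (r, c).
Definition sqcolsum S x : R := \sum_(r < p) colsum S r x ^+ 2.

Lemma jointly_measurable_quad u : jointly_measurable (quad u).
Proof. by rewrite /quad; jmeas. Qed.

Lemma jointly_measurable_colsum S r : jointly_measurable (colsum S r).
Proof. by rewrite /colsum; jmeas. Qed.

Lemma jointly_measurable_sqcolsum S : jointly_measurable (sqcolsum S).
Proof. by rewrite /sqcolsum /colsum; jmeas. Qed.

Lemma colsum_ignores S r r' c : (r != r') || (c \notin S) ->
  ignores (colsum S r) (r', c).
Proof.
move=> rc x y; apply: eq_bigr => c' c'S; rewrite /upd; case: eqP => // -[? ?].
by subst r' c'; rewrite eqxx c'S in rc.
Qed.

Lemma EX_gaussian_row u S r (t : R) (z rest : ('I_p * 'I_n -> R) -> R) :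
    let v := \sum_(c in S) u c ^+ 2 in
    t * v < 1 -> jointly_measurable z -> jointly_measurable rest ->
    (forall x, 0 <= rest x) -> {in S, forall c, ignores z (r, c)} ->
    {in S, forall c, ignores rest (r, c)} ->
  EX (fun x => expR (t / 2 * (z x + \sum_(c in S) u c * x (r, c)) ^+ 2) * rest x) =
  ((expR (- ln (1 - t * v) / 2))%:E *
   EX (fun x => expR (t / (1 - t * v) / 2 * z x ^+ 2) * rest x)%R)%E.
Proof.
move=> v tv mz mr r0 zi ri.
pose s := [seq (r, c) | c <- enum S].
have sE (f : 'I_p * 'I_n -> R) : \sum_(c in S) f (r, c) = \sum_(i <- s) f i.
  by rewrite big_map big_enum.
have vE : v = \sum_(i <- s) u i.2 ^+ 2 by rewrite -sE.
have us : uniq s by rewrite map_inj_uniq ?enum_uniq// => ? ? [].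
have tv' : t * (\sum_(i <- s) u i.2 ^+ 2) < 1 by rewrite -vE.
have zs : {in s, forall i, ignores z i}.
  by move=> _ /mapP[c cS ->]; apply: zi; rewrite mem_enum in cS.
have rs : {in s, forall i, ignores rest i}.
  by move=> _ /mapP[c cS ->]; apply: ri; rewrite mem_enum in cS.
have := EX_gaussian_sum iidX us tv' mz mr r0 zs rs.
rewrite /= -vE => <-; congr (EX _); apply/funext => x.
by rewrite -(sE (fun i => u i.2 * x i)).
Qed.

(** For a unit vector [u], the Laplace transform of the chi-squared law. *)
Lemma EX_quad u (t : R) : let v := \sum_(c < n) u c ^+ 2 in t * v < 1 ->
  EX (fun x => expR (t / 2 * quad u x)) = (expR (- (p%:R / 2) * ln (1 - t * v)))%:E.
Proof.
move=> v tv.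
have vE : \sum_(c in [set: 'I_n]%SET) u c ^+ 2 = v by apply: eq_bigl => c; rewrite inE.
pose H r x := expR (t / 2 * (0 + \sum_(c in [set: 'I_n]%SET) u c * x (r, c)) ^+ 2).
transitivity (EX (fun x => \prod_(r <- enum 'I_p) H r x)).
  congr (EX _); apply/funext => x; rewrite /quad mulr_sumr expR_sum big_enum /=.
  apply: eq_bigr => r _; rewrite /H add0r; congr (expR (_ * _ ^+ 2)).
  by apply: eq_bigl => c; rewrite inE.
rewrite (@EX_prod_rows _ _ _ P _ X _ _ (fun r i => i.1 == r) H (expR (- ln (1 - t * v) / 2))).
- rewrite size_enum_ord; congr EFin; rewrite -expRM_natl; congr expR.
  by field.
- exact: enum_uniq.
- exact: expR_ge0.
- by move=> r x; exact: expR_ge0.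
- by move=> r; rewrite /H; jmeas.
- move=> r r' [r'' c] /= rr' /eqP -> x y; rewrite /H; congr (expR (_ * (_ + _) ^+ 2)).
  by apply: eq_bigr => c' _; rewrite /upd xpair_eqE eq_sym (negbTE rr').
- move=> r rest mr r0 rr.
  have := @EX_gaussian_row u [set: 'I_n]%SET r t (fun=> 0) rest.
  rewrite /= vE => -> //.
  + congr (_ * EX _)%E; apply/funext => x.
    by rewrite expr0n /= mulr0 expR0 mul1r.
  + by move=> c _; apply: rr => /=.
Qed.

Lemma colsumD F G r x : colsum F r x = colsum (F :&: G) r x + colsum (F :\: G) r x.
Proof. exact: big_setID. Qed.

Lemma EX_colsum_row S r (t : R) (z rest : ('I_p * 'I_n -> R) -> R) :
    t * #|S|%:R < 1 -> jointly_measurable z -> jointly_measurable rest ->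
    (forall x, 0 <= rest x) -> {in S, forall c, ignores z (r, c)} ->
    {in S, forall c, ignores rest (r, c)} ->
  EX (fun x => expR (t / 2 * (z x + colsum S r x) ^+ 2) * rest x) =
  ((expR (- ln (1 - t * #|S|%:R) / 2))%:E *
   EX (fun x => expR (t / (1 - t * #|S|%:R) / 2 * z x ^+ 2) * rest x)%R)%E.
Proof.
move=> tS mz mr r0 zi ri.
have vE : \sum_(c in S) (1 : R) ^+ 2 = #|S|%:R by rewrite expr1n sumr_const.
have := @EX_gaussian_row (fun=> 1) S r t z rest.
rewrite /= vE => <- //; congr (EX _); apply/funext => x.
by congr (expR (_ * (_ + _) ^+ 2) * _); apply: eq_bigr => c _; rewrite mul1r.
Qed.

(** In each row, the columns of F outside G and those of G outside F are
    integrated out first, given the common columns. This turns [t] and [t'] into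
    [a] and [a'], and leaves a single Gaussian sum over the common columns. *)
Lemma EX_overlap F G (t t' s : R) :
    let a := t / (1 - t * #|F :\: G|%:R) in
    let a' := t' / (1 - t' * #|G :\: F|%:R) in
    t * #|F :\: G|%:R < 1 -> t' * #|G :\: F|%:R < 1 ->
    (a + a' + s) * #|F :&: G|%:R < 1 ->
  EX (fun x => expR (t / 2 * sqcolsum F x + t' / 2 * sqcolsum G x +
                     s / 2 * sqcolsum (F :&: G) x)) =
  (expR (- (p%:R / 2) * (ln (1 - t * #|F :\: G|%:R) + ln (1 - t' * #|G :\: F|%:R) +
     ln (1 - (a + a' + s) * #|F :&: G|%:R))))%:E.
Proof.
move=> a a' h1 h2 h3.
pose H r x := expR (t / 2 * colsum F r x ^+ 2) * (expR (t' / 2 * colsum G r x ^+ 2) *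
  expR (s / 2 * colsum (F :&: G) r x ^+ 2)).
have mc := jointly_measurable_colsum.
transitivity (EX (fun x => \prod_(r <- enum 'I_p) H r x)).
  congr (EX _); apply/funext => x; rewrite /sqcolsum !mulr_sumr -!big_split expR_sum big_enum /=.
  by apply: eq_bigr => r _; rewrite /H -!expRD addrA.
set c1 := ln _; set c2 := ln _; set c3 := ln _.
rewrite (@EX_prod_rows _ _ _ P _ X _ _ (fun r i => i.1 == r) H
  (expR (- c1 / 2) * (expR (- c2 / 2) * expR (- c3 / 2)))).
- rewrite size_enum_ord; congr EFin; rewrite -!expRD -expRM_natl; congr expR.
  by field.
- exact: enum_uniq.
- by rewrite !mulr_ge0 ?expR_ge0.
- by move=> r x; rewrite !mulr_ge0 ?expR_ge0.
- by move=> r; rewrite /H; jmeas; exact: mc.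
- move=> r r' [r'' c] /= rr' /eqP -> x y; rewrite /H.
  by rewrite !colsum_ignores// eq_sym rr'.
- move=> r rest mr r0 rr.
  have ir S x y c : c \notin S -> colsum S r (upd x (r, c) y) = colsum S r x.
    by move=> cS; rewrite colsum_ignores// cS orbT.
  transitivity (EX (fun x => expR (t / 2 * (colsum (F :&: G) r x + colsum (F :\: G) r x) ^+ 2) *
     (expR (t' / 2 * colsum G r x ^+ 2) * expR (s / 2 * colsum (F :&: G) r x ^+ 2) * rest x))).
    by congr (EX _); apply/funext => x; rewrite -colsumD /H -!mulrA.
  rewrite EX_colsum_row//; last first.
  + move=> c; rewrite !inE => /andP[cG cF] x y.
    by rewrite !ir ?rr ?inE ?(negbTE cG) ?andbF//=.
  + move=> c; rewrite !inE => /andP[cG cF] x y.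
    by rewrite !ir ?inE ?(negbTE cG) ?andbF//=.
  + by move=> x; rewrite !mulr_ge0 ?expR_ge0.
  + by jmeas; exact: mc.
  rewrite -/a -/c1.
  transitivity ((expR (- c1 / 2))%:E * EX (fun x =>
      expR (t' / 2 * (colsum (G :&: F) r x + colsum (G :\: F) r x) ^+ 2) *
      (expR ((a + s) / 2 * colsum (F :&: G) r x ^+ 2) * rest x))%R)%E.
    congr (_ * EX _)%E; apply/funext => x; rewrite -colsumD.
    by rewrite mulrDl mulrDl expRD; ring.
  rewrite EX_colsum_row//; last first.
  + move=> c; rewrite !inE => /andP[cF cG] x y.
    by rewrite !ir ?rr ?inE ?(negbTE cF)//=.
  + move=> c; rewrite !inE => /andP[cF cG] x y.
    by rewrite !ir ?inE ?(negbTE cF) ?andbF//=.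
  + by move=> x; rewrite !mulr_ge0 ?expR_ge0.
  + by jmeas; exact: mc.
  rewrite -/a' -/c2.
  transitivity ((expR (- c1 / 2))%:E * ((expR (- c2 / 2))%:E * EX (fun x =>
      expR ((a + a' + s) / 2 * (0 + colsum (F :&: G) r x) ^+ 2) * rest x)%R))%E.
    congr (_ * (_ * EX _))%E; apply/funext => x; rewrite finset.setIC add0r.
    by rewrite mulrA -expRD; congr (expR _ * _); ring.
  rewrite EX_colsum_row//; last first.
  + by move=> c _; apply: rr => /=.
  rewrite -/c3 !EFinM -!muleA; congr (_ * (_ * (_ * EX _)))%E; apply/funext => x.
  by rewrite expr0n /= mulr0 expR0 mul1r.
Qed.
End gaussian_matrix.

(** * The largest eigenvalue of a Gram matrix *)

(** Cauchy-Schwarz, from Lagrange's identity. *)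
Lemma sum_mul_sqr_le (R : realType) (J : finType) (f g : J -> R) :
  (\sum_j f j * g j) ^+ 2 <= (\sum_j f j ^+ 2) * (\sum_j g j ^+ 2).
Proof.
have H : 0 <= \sum_i \sum_j (f i * g j - f j * g i) ^+ 2.
  by apply: sumr_ge0 => i _; apply: sumr_ge0 => j _; exact: sqr_ge0.
suff E : \sum_i \sum_j (f i * g j - f j * g i) ^+ 2 =
   2 * ((\sum_j f j ^+ 2) * (\sum_j g j ^+ 2) - (\sum_j f j * g j) ^+ 2).
  by rewrite E pmulr_rge0// subr_ge0 in H.
rewrite expr2 !big_distrlr /= -sumrB [in RHS]mulr_sumr.
transitivity (\sum_i \sum_j (f i ^+ 2 * g j ^+ 2 - f i * g i * (f j * g j)) +
    \sum_i \sum_j (f j ^+ 2 * g i ^+ 2 - f i * g i * (f j * g j))).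
  rewrite -big_split; apply: eq_bigr => i _; rewrite -big_split /=.
  by apply: eq_bigr => j _; ring.
rewrite [X in _ + X]exchange_big /= -big_split /=; apply: eq_bigr => i _.
rewrite -sumrB mulr_sumr -big_split /=.
by apply: eq_bigr => j _; ring.
Qed.

Section rayleigh.
Context {R : realType}.

Definition sqnorm (m : nat) (v : 'rV[R]_m) : R := \sum_j v 0 j ^+ 2.

Lemma sqnormE m (v : 'rV[R]_m) : sqnorm v = (v *m v^T) 0 0.
Proof. by rewrite mxE; apply: eq_bigr => j _; rewrite mxE. Qed.

Lemma sqnorm_ge0 m (v : 'rV[R]_m) : 0 <= sqnorm v.
Proof. by apply: sumr_ge0 => j _; exact: sqr_ge0. Qed.

Lemma sqnorm_eq0 m (v : 'rV[R]_m) : (sqnorm v == 0) = (v == 0).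
Proof.
rewrite psumr_eq0; last by move=> j _; exact: sqr_ge0.
apply/allP/eqP => [v0|-> j _]; last by rewrite mxE expr0n /= eqxx.
apply/rowP => j; rewrite mxE; apply/eqP; rewrite -sqrf_eq0.
by have /implyP := v0 j (mem_index_enum j); exact.
Qed.

Lemma sqnormZ m a (v : 'rV[R]_m) : sqnorm (a *: v) = a ^+ 2 * sqnorm v.
Proof. by rewrite /sqnorm mulr_sumr; apply: eq_bigr => j _; rewrite mxE exprMn. Qed.

Lemma sqnorm_mulmx m q (v : 'rV[R]_m) (C : 'M[R]_(m, q)) :
  sqnorm (v *m C) <= (\sum_j \sum_i C i j ^+ 2) * sqnorm v.
Proof.
rewrite /sqnorm mulr_suml; apply: ler_sum => j _; rewrite mxE mulrC.
exact: sum_mul_sqr_le.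
Qed.

(** [L] is the supremum of the Rayleigh quotients. If it were not an eigenvalue,
    the positive semidefinite matrix L - B^T B would be invertible, hence bounded
    below by a positive multiple of the identity, and a smaller bound than [L]
    would hold for all Rayleigh quotients. *)
Lemma gram_eigenvalue_max (p m : nat) (B : 'M[R]_(p, m.+1)) :
  exists L, [/\ 0 <= L, eigenvalue (B^T *m B) L &
    forall v : 'rV[R]_m.+1, sqnorm (v *m B^T) <= L * sqnorm v].
Proof.
pose Q := [set sqnorm (v *m B^T) / sqnorm v | v in [set v : 'rV[R]_m.+1 | v != 0]].
have pos (v : 'rV[R]_m.+1) : v != 0 -> 0 < sqnorm v.
  by move=> v0; rewrite lt_neqAle eq_sym sqnorm_eq0 v0 sqnorm_ge0.
have ubQ : has_ubound Q.
  exists (\sum_j \sum_i B^T i j ^+ 2) => _ [v v0 <-].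
  by rewrite ler_pdivrMr ?pos//; exact: sqnorm_mulmx.
pose L := sup Q.
have LP (v : 'rV[R]_m.+1) : sqnorm (v *m B^T) <= L * sqnorm v.
  have [->|v0] := eqVneq v 0.
    by rewrite mul0mx (eqP (_ : sqnorm 0 == 0)) ?sqnorm_eq0//=
      (eqP (_ : sqnorm 0 == 0)) ?sqnorm_eq0// mulr0.
  by rewrite -ler_pdivrMr ?pos//; apply: ub_le_sup => //; exists v.
have one0 : (const_mx 1 : 'rV[R]_m.+1) != 0.
  by apply/eqP => /rowP/(_ ord0); rewrite !mxE => /eqP; rewrite oner_eq0.
have Q0 : Q !=set0.
  exists (sqnorm (const_mx 1 *m B^T) / sqnorm (const_mx 1 : 'rV_m.+1)).
  by exists (const_mx 1).
have L0 : 0 <= L.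
  have := LP (const_mx 1); move/(le_trans (sqnorm_ge0 _)).
  by rewrite pmulr_lge0// pos.
exists L; split => //.
pose H := L%:M - B^T *m B.
pose b (v w : 'rV[R]_m.+1) := (v *m H *m w^T) 0 0.
have sqmulE (v : 'rV[R]_m.+1) : sqnorm (v *m B^T) = (v *m (B^T *m B) *m v^T) 0 0.
  by rewrite sqnormE trmx_mul trmxK !mulmxA.
have bE v : b v v = L * sqnorm v - sqnorm (v *m B^T).
  rewrite /b /H mulmxBr mulmxBl mul_mx_scalar -scalemxAl sqmulE.
  by rewrite mxE [X in X + _]mxE [X in _ + X]mxE -sqnormE.
have HT : H^T = H by rewrite /H linearB /= tr_scalar_mx trmx_mul trmxK.
have [Hu|] := boolP (H \in unitmx); last first.
  rewrite unitmxE unitfE negbK => /det0P[v v0 vH].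
  apply/eigenvalueP; exists v => //; apply/eqP.
  by rewrite -subr_eq0 -oppr_eq0 opprB -mul_mx_scalar -mulmxBr -/H vH.
exfalso.
have bge0 v : 0 <= b v v by rewrite bE subr_ge0.
have ble v : b v v <= (L + 1) * sqnorm v.
  by rewrite bE lerBlDr mulrDl -addrA lerDl addr_ge0 ?mul1r// sqnorm_ge0.
have L1 : 0 < L + 1 by rewrite ltr_wpDl.
(* Evaluate the form at v - t (v H), with t the inverse of an upper bound for it. *)
have nvH (v : 'rV[R]_m.+1) : sqnorm (v *m H) <= (L + 1) * b v v.
  pose t := (L + 1)^-1; pose w := v *m H.
  have := bge0 (v - t *: w).
  have -> : b (v - t *: w) (v - t *: w) = b v v - 2 * t * sqnorm w + t ^+ 2 * b w w.
    have bvw : b v w = sqnorm w by rewrite /b sqnormE.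
    have bwv : b w v = sqnorm w.
      by rewrite /b sqnormE -mulmxA; congr ((_ *m _) 0 0); rewrite /w trmx_mul HT.
    have -> : b (v - t *: w) (v - t *: w) = b v v - t * b w v - t * b v w + t ^+ 2 * b w w.
      have -> : b (v - t *: w) (v - t *: w) =
          (v *m H *m v^T - t *: (v *m H *m w^T) -
           (t *: (w *m H *m v^T) - t *: (t *: (w *m H *m w^T)))) 0 0.
        have -> : b (v - t *: w) (v - t *: w) =
            ((v - t *: w) *m H *m (v^T - t *: w^T)) 0 0.
          by rewrite /b; congr ((_ *m _) 0 0); apply/matrixP => i j; rewrite !mxE.
        clearbody H.
        by rewrite !mulmxBl !mulmxBr -!scalemxAl -!scalemxAr.
      rewrite /b.
      move: (v *m H *m v^T) (v *m H *m w^T) (w *m H *m v^T) (w *m H *m w^T).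
      by move=> e1 e2 e3 e4; rewrite !mxE; ring.
    by rewrite bvw bwv; ring.
  have tw : t ^+ 2 * b w w <= t * sqnorm w.
    rewrite expr2 -mulrA ler_pM2l ?invr_gt0// /t mulrC ler_pdivrMr//.
    by rewrite mulrC ble.
  rewrite -ler_pdivrMl// -/t -/w => h.
  by move: tw h; lra.
pose D := \sum_j \sum_i invmx H i j ^+ 2 + 1.
have D1 : 0 < D.
  by rewrite ltr_wpDl// sumr_ge0// => j _; apply: sumr_ge0 => i _; exact: sqr_ge0.
have K0 : 0 < D * (L + 1) by rewrite mulr_gt0.
have nv (v : 'rV[R]_m.+1) : sqnorm v <= D * (L + 1) * b v v.
  rewrite -[in leLHS](mulmxK Hu v); apply: (le_trans (sqnorm_mulmx _ _)).
  rewrite -mulrA; apply: ler_pM => //.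
  - by apply: sumr_ge0 => j _; apply: sumr_ge0 => i _; exact: sqr_ge0.
  - exact: sqnorm_ge0.
  - by rewrite lerDl.
suff : L <= L - (D * (L + 1))^-1 by rewrite lerBrDr gerDl leNgt invr_gt0 K0.
apply: ge_sup => // _ [v v0 <-]; rewrite ler_pdivrMr ?pos//.
by rewrite mulrBl lerBrDl -lerBrDr -bE mulrC ler_pdivrMr// mulrC nv.
Qed.

Lemma lambda_max_gram (p m : nat) (B : 'M[R]_(p, m)) : (0 < m)%N ->
  let L := lambda_max (B^T *m B) in
  (forall v : 'rV[R]_m, sqnorm (v *m B^T) <= L * sqnorm v) /\
  (exists2 v : 'rV[R]_m, v != 0 & sqnorm (v *m B^T) = L * sqnorm v).
Proof.
case: m B => // m B _; have [L [L0 /eigenvalueP[v vL v0] LP]] := gram_eigenvalue_max B.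
have pos (w : 'rV[R]_m.+1) : w != 0 -> 0 < sqnorm w.
  by move=> w0; rewrite lt_neqAle eq_sym sqnorm_eq0 w0 sqnorm_ge0.
have eigE (w : 'rV[R]_m.+1) a : w *m (B^T *m B) = a *: w -> sqnorm (w *m B^T) = a * sqnorm w.
  move=> wa; rewrite sqnormE trmx_mul trmxK mulmxA -(mulmxA w) wa.
  by rewrite -scalemxAl mxE -sqnormE.
have ub a : eigenvalue (B^T *m B) a -> a <= L.
  by move=> /eigenvalueP[w wa w0]; have := LP w; rewrite (eigE _ _ wa) ler_pM2r// pos.
have Lev : eigenvalue (B^T *m B) L by apply/eigenvalueP; exists v.
rewrite /lambda_max /=; set S := sup _.
have -> : S = L.
  apply/eqP; rewrite eq_le; apply/andP; split.
    by apply: ge_sup; [exists L|move=> a /ub].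
  by apply: ub_le_sup; [exists L => a /ub|].
by split => //; exists v => //; exact: eigE.
Qed.
End rayleigh.

(** * Variational formula over sparse vectors, and finite grids *)
Section largest_gram_eigenvalue.
Context {R : realType} (p n k : nat).
Hypotheses (k0 : (0 < k)%N) (kn : (k <= n)%N).
Implicit Types (x : 'I_p * 'I_n -> R) (u : 'I_n -> R) (S : {set 'I_n}).

Definition max_eig x : R := max_gram_eigenvalue k (\matrix_(i < p, j < n) x (i, j)).

Lemma sum_supported S u (f : 'I_n -> R) : {in ~: S, forall c, u c = 0} ->
  \sum_c u c * f c = \sum_(j < #|S|) u (enum_val j) * f (enum_val j).
Proof.
move=> uS; transitivity (\sum_(c in S) u c * f c); last exact: big_enum_val.
rewrite [RHS]big_mkcond.
by apply: eq_bigr => c _; case: ifPn => // cS; rewrite uS ?inE// mul0r.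
Qed.

Lemma sqnorm_supported S u : {in ~: S, forall c, u c = 0} ->
  sqnorm (\row_(j < #|S|) u (enum_val j)) = \sum_c u c ^+ 2.
Proof.
move=> uS; under [RHS]eq_bigr do rewrite expr2; rewrite (sum_supported u uS).
by apply: eq_bigr => j _; rewrite mxE expr2.
Qed.

Lemma quad_supported S u x : {in ~: S, forall c, u c = 0} ->
  quad u x = sqnorm (\row_(j < #|S|) u (enum_val j) *m
                     (cols (\matrix_(i < p, j < n) x (i, j)) S)^T).
Proof.
move=> uS; apply: eq_bigr => r _; congr (_ ^+ 2).
rewrite (sum_supported (fun c => x (r, c)) uS) mxE.
by apply: eq_bigr => j _; rewrite !mxE.
Qed.

Lemma max_eig_argmax x : exists2 S : {set 'I_n}, #|S| = k &
  let l S := lambda_max ((cols (\matrix_(i < p, j < n) x (i, j)) S)^T *m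
      cols (\matrix_(i < p, j < n) x (i, j)) S) in
  max_eig x = l S /\ forall S', #|S'| = k -> l S' <= l S.
Proof.
pose l S := lambda_max ((cols (\matrix_(i < p, j < n) x (i, j)) S)^T *m
      cols (\matrix_(i < p, j < n) x (i, j)) S).
have [S0 S0k] : exists S0 : {set 'I_n}, #|S0| == k.
  exists [set widen_ord kn j | j : 'I_k]%SET.
  rewrite card_imset ?card_ord// => i j /(congr1 val) /= ij; exact: val_inj.
have [S /eqP Sk Smax] : exists2 S : {set 'I_n}, #|S| == k &
    forall S' : {set 'I_n}, #|S'| == k -> l S' <= l S.
  by case: (@arg_maxP _ _ _ S0 (fun S : {set 'I_n} => #|S| == k) l S0k) => S Sk Sm; exists S.
exists S => //=; rewrite -/(l _); split; last by move=> S' S'k; apply: Smax; apply/eqP.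
apply/eqP; rewrite eq_le; apply/andP; split.
- apply: ge_sup; first by exists (l S); exists S.
  by move=> _ [S' /= S'k <-]; apply: Smax; apply/eqP.
- apply: ub_le_sup; last by exists S.
  by exists (l S) => _ [S' /= S'k <-]; apply: Smax; apply/eqP.
Qed.

Lemma quad_le_max_eig S u x : #|S| = k -> {in ~: S, forall c, u c = 0} ->
  quad u x <= max_eig x * \sum_c u c ^+ 2.
Proof.
move=> Sk uS; have [S' S'k [-> /(_ _ Sk)]] := max_eig_argmax x.
set l := lambda_max _ => ll.
rewrite (quad_supported x uS) -(sqnorm_supported uS).
have [+ _] := lambda_max_gram (cols (\matrix_(i < p, j < n) x (i, j)) S)
  (eq_ind_r (fun i => 0 < i)%N k0 Sk).
move=> /(_ (\row_j u (enum_val j))) h; apply: (le_trans h).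
by rewrite ler_wpM2r ?sqnorm_ge0.
Qed.

Lemma max_eig_attained x : exists S u, [/\ #|S| = k, {in ~: S, forall c, u c = 0},
  \sum_c u c ^+ 2 = 1 & quad u x = max_eig x].
Proof.
have [S Sk [tE _]] := max_eig_argmax x.
have [_ [v v0 vE]] := lambda_max_gram (cols (\matrix_(i < p, j < n) x (i, j)) S)
  (eq_ind_r (fun i => 0 < i)%N k0 Sk).
have nv : 0 < sqnorm v by rewrite lt_neqAle eq_sym sqnorm_eq0 v0 sqnorm_ge0.
pose w := (Num.sqrt (sqnorm v))^-1 *: v.
have nw : sqnorm w = 1.
  by rewrite sqnormZ exprVn sqr_sqrtr ?ltW// mulVf// gt_eqF.
have wE : sqnorm (w *m (cols (\matrix_(i < p, j < n) x (i, j)) S)^T) = max_eig x.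
  by rewrite -scalemxAl sqnormZ vE tE mulrCA -sqnormZ nw mulr1.
pose u c := \sum_(j < #|S| | enum_val j == c) w 0 j.
have uE j : u (enum_val j) = w 0 j.
  rewrite /u (big_pred1 j)// => i; apply/eqP/eqP => [|->//]; exact: enum_val_inj.
have uS : {in ~: S, forall c, u c = 0}.
  move=> c; rewrite inE => cS; rewrite /u big1// => j /eqP jc.
  by rewrite -jc enum_valP in cS.
have rE : \row_j u (enum_val j) = w by apply/rowP => j; rewrite mxE uE.
exists S, u; split => //; first by rewrite -(sqnorm_supported uS) rE.
by rewrite (quad_supported x uS) rE.
Qed.

Lemma quad_ge0 u x : 0 <= quad u x.
Proof. by apply: sumr_ge0 => r _; exact: sqr_ge0. Qed.

Lemma max_eig_ge0 x : 0 <= max_eig x.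
Proof. by have [S [u [_ _ _ <-]]] := max_eig_attained x; exact: quad_ge0. Qed.

Lemma card_supset (A : {set 'I_n}) : (#|A| <= k)%N ->
  exists2 S : {set 'I_n}, A \subset S & #|S| = k.
Proof.
move=> Ak; have [m] := ubnP (k - #|A|); elim: m A Ak => // m IH A Ak km.
have [Ek|nk] := eqVneq #|A| k; first by exists A.
have Alt : (#|A| < k)%N by rewrite ltn_neqAle nk.
have [c cA] : exists c, c \notin A.
  apply/existsP; rewrite -negb_forall; apply/negP => /forallP Aall.
  have : #|A| = n by rewrite -[RHS]card_ord; apply: eq_card => c; rewrite Aall.
  by move=> An; rewrite An ltnNge kn in Alt.
have [||S AS Sk] := IH (c |: A)%SET.
- by rewrite cardsU1 cA.
- rewrite cardsU1 cA add1n subnS; move: km; rewrite ltnS.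
  by case: (k - #|A|)%N (subn_gt0 #|A| k) => [|j]; [rewrite Alt|].
- by exists S => //; apply: (fintype.subset_trans _ AS); exact: finset.subsetUr.
Qed.

(** The grid has mesh [1 / m] in [-1, 1], and [f] selects the support. Values are
    added when [f] is not injective, so that every pair [(f, g)] gives a vector
    supported on at most [k] coordinates. *)
Definition gridvec (m : nat) (f : {ffun 'I_k -> 'I_n})
    (g : {ffun 'I_k -> 'I_(2 * m).+1}) (c : 'I_n) : R :=
  \sum_(j < k | f j == c) ((g j)%:R - m%:R) / m%:R.

Lemma quad_gridvec_le m f g x :
  quad (@gridvec m f g) x <= max_eig x * \sum_c gridvec f g c ^+ 2.
Proof.
have [S fS Sk] := @card_supset (f @: 'I_k) (leq_trans (leq_imset_card _ _) (eq_leq (card_ord k))).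
apply: (quad_le_max_eig x Sk) => c; rewrite inE => cS; rewrite /gridvec big1// => j /eqP fj.
by rewrite -fj (fintype.subsetP fS) ?imset_f in cS.
Qed.

(** A substitute for the triangle inequality that involves no square root. *)
Lemma quad_add_le (theta : R) u u' x : 0 < theta ->
  quad (fun c => u c + u' c) x <= (1 + theta) * quad u x + (1 + theta^-1) * quad u' x.
Proof.
move=> t0; rewrite /quad !mulr_sumr -big_split; apply: ler_sum => r _ /=.
have -> : \sum_c (u c + u' c) * x (r, c) = \sum_c u c * x (r, c) + \sum_c u' c * x (r, c).
  by rewrite -big_split; apply: eq_bigr => c _; rewrite mulrDl.
set a := (X in (X + _) ^+ 2); set b := (X in (_ + X) ^+ 2).
rewrite -subr_ge0.
have -> : (1 + theta) * a ^+ 2 + (1 + theta^-1) * b ^+ 2 - (a + b) ^+ 2 =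
   (theta * a - b) ^+ 2 / theta by field; rewrite gt_eqF.
by rewrite divr_ge0 ?sqr_ge0// ltW.
Qed.

Lemma sumsq_add_le (theta : R) u u' : 0 < theta ->
  \sum_c (u c + u' c) ^+ 2 <=
  (1 + theta) * (\sum_c u c ^+ 2) + (1 + theta^-1) * (\sum_c u' c ^+ 2).
Proof.
move=> t0; rewrite !mulr_sumr -big_split; apply: ler_sum => c _ /=.
set a := u c; set b := u' c; rewrite -subr_ge0.
have -> : (1 + theta) * a ^+ 2 + (1 + theta^-1) * b ^+ 2 - (a + b) ^+ 2 =
   (theta * a - b) ^+ 2 / theta by field; rewrite gt_eqF.
by rewrite divr_ge0 ?sqr_ge0// ltW.
Qed.

Lemma grid_round (m : nat) (y : R) : (0 < m)%N -> y ^+ 2 <= 1 ->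
  exists i : 'I_(2 * m).+1, (y - (i%:R - m%:R) / m%:R) ^+ 2 <= (m%:R^-1) ^+ 2.
Proof.
move=> m0 y1; have m1 : 0 < m%:R :> R by rewrite ltr0n.
have [y2 y3] : -1 <= y /\ y <= 1.
  by split; rewrite leNgt; apply/negP => h; nra.
pose z := m%:R * y + m%:R.
have z0 : 0 <= z by rewrite /z; nra.
have z2 : z <= (2 * m)%:R by rewrite natrM /z; nra.
have /andP[t1 t2] := truncn_itv z0.
have tm : (Num.truncn z < (2 * m).+1)%N.
  by rewrite ltnS -(ler_nat R) (le_trans t1).
exists (Ordinal tm) => /=; set t := (Num.truncn z)%:R in t1 t2 *.
rewrite -natr1 in t2.
have -> : y - (t - m%:R) / m%:R = (z - t) / m%:R by rewrite /z; field; rewrite gt_eqF.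
rewrite exprMn exprVn ler_piMl ?invr_ge0 ?sqr_ge0//.
by rewrite expr_le1// -?/t; lra.
Qed.

(** Round a maximizer u to a grid vector u'. The error h = u - u' is supported on
    the same k coordinates, so that |X h|^2 <= T |h|^2 <= T theta^2 is bounded in
    terms of T itself. *)
Lemma grid_net (theta : R) (m : nat) x : 0 < theta -> theta <= 1 / 4 -> (0 < m)%N ->
    k%:R <= theta ^+ 2 * m%:R ^+ 2 ->
  exists f g, let v := \sum_c @gridvec m f g c ^+ 2 in
    0 < v /\ (1 - 4 * theta) * max_eig x * v <= quad (gridvec f g) x.
Proof.
move=> t0 t4 m0 km.
have [S [u [Sk uS u1 qu]]] := max_eig_attained x.
have /choice[g_ gP] (j : 'I_k) : exists i : 'I_(2 * m).+1,
    (u (enum_val (cast_ord (esym Sk) j)) - (i%:R - m%:R) / m%:R) ^+ 2 <= (m%:R^-1) ^+ 2.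
  apply: grid_round => //; rewrite -u1.
  rewrite (bigD1 (enum_val (cast_ord (esym Sk) j)))//= lerDl sumr_ge0// => c _.
  exact: sqr_ge0.
pose f := [ffun j : 'I_k => enum_val (cast_ord (esym Sk) j)].
pose g := [ffun j : 'I_k => g_ j].
pose u' := @gridvec m f g; pose h c := u c - u' c.
have finj : injective f.
  by move=> i j; rewrite !ffunE => /enum_val_inj /cast_ord_inj.
have u'E j : u' (f j) = ((g j)%:R - m%:R) / m%:R.
  by rewrite /u' /gridvec (big_pred1 j)// => i; exact: (inj_eq finj).
have u'S : {in ~: S, forall c, u' c = 0}.
  move=> c; rewrite inE => cS; rewrite /u' /gridvec big1// => j /eqP; rewrite ffunE => fj.
  by rewrite -fj enum_valP in cS.
have hS : {in ~: S, forall c, h c = 0} by move=> c cS; rewrite /h uS ?u'S ?subrr.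
have m1 : 0 < m%:R :> R by rewrite ltr0n.
have nh : \sum_c h c ^+ 2 <= theta ^+ 2.
  apply: (@le_trans _ _ (k%:R * (m%:R^-1) ^+ 2)); last first.
    by rewrite exprVn ler_pdivrMr// exprn_gt0.
  have -> : \sum_c h c ^+ 2 = \sum_(j < k) h (f j) ^+ 2.
    under eq_bigr do rewrite expr2; rewrite (sum_supported h hS).
    rewrite (reindex (cast_ord (esym Sk))) /=; last first.
      by exists (cast_ord Sk) => ? _; rewrite ?cast_ordK ?cast_ordKV.
    by apply: eq_bigr => j _; rewrite ffunE expr2.
  rewrite mulr_natl -[X in _ *+ X](card_ord k) -sumr_const.
  by apply: ler_sum => j _; rewrite /h u'E; have := gP j; rewrite !ffunE.
have qh : quad h x <= max_eig x * theta ^+ 2.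
  by apply: (le_trans (quad_le_max_eig x Sk hS)); rewrite ler_wpM2l ?max_eig_ge0.
exists f, g; rewrite -/u' /=.
set v := \sum_c _.
have v0 : 0 <= v by apply: sumr_ge0 => c _; exact: sqr_ge0.
have tp := max_eig_ge0 x.
have e1 : max_eig x <= (1 + theta) * quad u' x + (1 + theta^-1) * (max_eig x * theta ^+ 2).
  rewrite -{1}qu; have -> : quad u x = quad (fun c => u' c + h c) x.
    by congr quad; apply/funext => c; rewrite /h addrC subrK.
  apply: (le_trans (quad_add_le _ _ _ t0)); rewrite lerD2l ler_wpM2l//.
  by rewrite addr_ge0// invr_ge0 ltW.
have e2 : v <= (1 + theta) ^+ 2.
  have -> : v = \sum_c (u c + - h c) ^+ 2.
    by apply: eq_bigr => c _; rewrite /h opprB addrC subrK.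
  apply: (le_trans (sumsq_add_le _ _ t0)); rewrite u1.
  under eq_bigr do rewrite sqrrN.
  have : (1 + theta^-1) * (\sum_c h c ^+ 2) <= (1 + theta^-1) * theta ^+ 2.
    by rewrite ler_wpM2l// addr_ge0// invr_ge0 ltW.
  have -> : (1 + theta^-1) * theta ^+ 2 = theta ^+ 2 + theta by field; rewrite gt_eqF.
  by move: (\sum_c _) => s; nra.
split.
  rewrite lt_neqAle v0 andbT; apply/negP => /eqP ve.
  have u'0 c : u' c = 0.
    apply/eqP; rewrite -sqrf_eq0; move: ve => /esym/eqP.
    by rewrite psumr_eq0 => [/allP/(_ c (mem_index_enum c))//|i _]; exact: sqr_ge0.
  have : \sum_c h c ^+ 2 = 1 by rewrite -u1; apply: eq_bigr => c _; rewrite /h u'0 subr0.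
  by move=> h1; rewrite h1 in nh; nra.
have e3 : (1 + theta^-1) * (max_eig x * theta ^+ 2) = max_eig x * (theta ^+ 2 + theta).
  by field; rewrite gt_eqF.
rewrite e3 in e1.
have e4 : (1 - 4 * theta) * max_eig x * v <= (1 - 4 * theta) * max_eig x * (1 + theta) ^+ 2.
  by rewrite ler_wpM2l// mulr_ge0//; lra.
have e5 : (1 + theta) * ((1 - 4 * theta) * (1 + theta) ^+ 2) <= 1 - theta - theta ^+ 2.
  by nra.
have e6 : (1 + theta) * ((1 - 4 * theta) * max_eig x * v) <= (1 + theta) * quad u' x.
  apply: (@le_trans _ _ (max_eig x * (1 - theta - theta ^+ 2))); last by nra.
  apply: (@le_trans _ _ (max_eig x * ((1 + theta) * ((1 - 4 * theta) * (1 + theta) ^+ 2)))).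
    have : 0 < 1 + theta by lra.
    by nra.
  by rewrite ler_wpM2l.
by rewrite ler_pM2l in e6; lra.
Qed.

End largest_gram_eigenvalue.

(** * Measurability and upper tail *)
Section expectation_bounds.
Context {R : realType} (d : measure_display) (T : measurableType d).
Context (P : probability T R) (I : finType) (X : I -> {RV P >-> R}).
Local Notation EX := (EX X).

Lemma EX_sum (J : Type) (s : seq J) (F : J -> (I -> R) -> R) :
    (forall j, jointly_measurable (F j)) -> (forall j x, 0 <= F j x) ->
  EX (fun x => \sum_(j <- s) F j x) = (\sum_(j <- s) EX (F j))%E.
Proof.
move=> mF F0; rewrite /EX -ge0_integral_sum//.
- by apply: eq_integral => w _; rewrite sumEFin.
- by move=> j; apply/measurable_EFinP; exact: measurable_EX.
- by move=> j w _; rewrite lee_fin.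
Qed.

Lemma EX_sum_cond (J : Type) (s : seq J) (q : pred J) (F : J -> (I -> R) -> R) :
    (forall j, jointly_measurable (F j)) -> (forall j x, 0 <= F j x) ->
  EX (fun x => \sum_(j <- s | q j) F j x) = (\sum_(j <- s | q j) EX (F j))%E.
Proof.
move=> mF F0; rewrite -[RHS]big_filter -EX_sum//; congr (EX _).
by apply/funext => x; rewrite big_filter.
Qed.
Lemma EX_add (F G : (I -> R) -> R) :
    jointly_measurable F -> (forall x, 0 <= F x) ->
    jointly_measurable G -> (forall x, 0 <= G x) ->
  EX (fun x => F x + G x) = (EX F + EX G)%E.
Proof.
move=> mF F0 mG G0; rewrite /EX -ge0_integralD//.
- by move=> w _; rewrite lee_fin.
- by apply/measurable_EFinP; exact: measurable_EX.
- by move=> w _; rewrite lee_fin.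
- by apply/measurable_EFinP; exact: measurable_EX.
Qed.

Lemma EX_cst (c : R) : EX (fun=> c) = c%:E.
Proof.
by rewrite /EX integral_cst// [X in (_ * X)%E](probability_setT P) mule1.
Qed.

Lemma probability_add_EX_le (A : set T) (F G : (I -> R) -> R) : measurable A ->
    jointly_measurable F -> (forall x, 0 <= F x) ->
    jointly_measurable G -> (forall x, 0 <= G x) ->
    (forall w, \1_A w + F (fun i => X i w) <= G (fun i => X i w)) ->
  (P A + EX F <= EX G)%E.
Proof.
move=> mA mF F0 mG G0 AFG; rewrite -[X in P X]setIT -integral_indic// /EX.
rewrite -ge0_integralD//.
- apply: ge0_le_integral => //.
  + by move=> w _; rewrite adde_ge0// lee_fin.
  + apply: emeasurable_funD; apply/measurable_EFinP; last exact: measurable_EX.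
    exact: measurable_indic.
  + by apply/measurable_EFinP; exact: measurable_EX.
  + by move=> w _; rewrite -EFinD lee_fin.
- by apply/measurable_EFinP; exact: measurable_indic.
- by move=> w _; rewrite lee_fin.
- by apply/measurable_EFinP; exact: measurable_EX.
Qed.

Lemma probability_le_EX (A : set T) (G : (I -> R) -> R) : measurable A ->
    jointly_measurable G -> (forall x, 0 <= G x) ->
    (forall w, A w -> 1 <= G (fun i => X i w)) ->
  (P A <= EX G)%E.
Proof.
move=> mA mG G0 AG.
suff : (P A + EX (fun=> 0%R) <= EX G)%E by rewrite EX_cst adde0.
apply: probability_add_EX_le => //.
move=> w; rewrite addr0 indicE; case: (boolP (w \in A)) => [|_]; last exact: G0.
by rewrite inE => /AG.
Qed.

End expectation_bounds.

Section upper_tail.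
Context {R : realType} (p n k : nat) (d : measure_display) (T : measurableType d).
Context (P : probability T R) (X : 'I_p * 'I_n -> {RV P >-> R}).
Hypotheses (k0 : (0 < k)%N) (kn : (k <= n)%N).
Hypothesis iidX : iid_with_law X (normal_prob 0 1).
Local Notation max_eigX := (fun w => max_eig k (fun i => X i w)).

Lemma grid_size (theta : R) : 0 < theta ->
  exists2 m : nat, (0 < m)%N & k%:R <= theta ^+ 2 * m%:R ^+ 2 :> R.
Proof.
move=> t0; pose m := (Num.truncn (k%:R / theta)).+1; exists m => //.
have km : k%:R / theta < m%:R by rewrite truncnS_gt.
rewrite -exprMn; have h : k%:R <= theta * m%:R.
  by rewrite -ler_pdivrMl// mulrC ltW.
have k1 : 1 <= k%:R :> R by rewrite ler1n.
by nra.
Qed.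

(** By [grid_net], [max_eig] exceeds [c] exactly when some grid vector, for some
    mesh, has a Rayleigh quotient larger than [c]. *)
Lemma measurable_max_eig : measurable_fun setT max_eigX.
Proof.
apply: (measurability _ (RGenOInfty.measurableE R)) => //.
move=> _ [_ [c ->] <-]; rewrite setTI preimage_itvoy.
have [c0|c0] := ltP c 0.
  rewrite (_ : [set _ | _] = setT)//; apply/seteqP; split => // w _ /=.
  exact: lt_le_trans c0 (max_eig_ge0 k0 kn _).
pose D m (fg : {ffun 'I_k -> 'I_n} * {ffun 'I_k -> 'I_(2 * m).+1}) :=
  [set w | c * (\sum_c gridvec fg.1 fg.2 c ^+ 2) < quad (gridvec fg.1 fg.2) (fun i => X i w)].
rewrite (_ : [set _ | _] = \bigcup_m \bigcup_(fg in setT) D m fg).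
  apply: bigcup_measurable => m _; apply: fin_bigcup_measurable => // fg _.
  rewrite /D; set a := c * _.
  have : measurable_fun setT (fun w => quad (gridvec fg.1 fg.2) (fun i => X i w)).
    by apply: measurable_EX; exact: jointly_measurable_quad.
  move=> /(_ measurableT _ (measurable_itv `]a, +oo[)).
  by rewrite setTI preimage_itvoy.
apply/seteqP; split=> [w /= ct|w [m _ [fg _]]]; last first.
  rewrite /D /= => /lt_le_trans /(_ (quad_gridvec_le k0 kn _ _ _)).
  by apply: contraTT; rewrite -!leNgt => h; rewrite ler_wpM2r// sumr_ge0// => ? _; exact: sqr_ge0.
set t := max_eig _ _ in ct.
have t0 : 0 < t by exact: le_lt_trans ct.
pose theta := (t - c) / (8 * t).
have th0 : 0 < theta by rewrite divr_gt0 ?subr_gt0// mulr_gt0.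
have th4 : theta <= 1 / 4 by rewrite /theta ler_pdivrMr ?mulr_gt0//; lra.
have [m m0 km] := grid_size th0.
have [f [g [v0 h]]] := grid_net k0 kn (fun i => X i w) th0 th4 m0 km.
exists m => //; exists (f, g) => //; rewrite /D /=; apply: lt_le_trans h.
rewrite ltr_pM2r// -/t.
have -> : (1 - 4 * theta) * t = (t + c) / 2 by rewrite /theta; field; rewrite gt_eqF.
by rewrite ltr_pdivlMr//; lra.
Qed.

Lemma measurable_max_eig_gt (c : R) : measurable [set w | c < max_eigX w].
Proof.
have := measurable_max_eig measurableT (measurable_itv `]c, +oo[).
by rewrite setTI preimage_itvoy.
Qed.

Lemma measurable_max_eig_lt (c : R) : measurable [set w | max_eigX w < c].
Proof.
have := measurable_max_eig measurableT (measurable_itv `]-oo, c[).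
by rewrite setTI preimage_itvNyo.
Qed.

(** The union bound over the grid vectors and the Chernoff bound for each of them,
    with the optimal parameter t = 1 - 1/y. *)
Lemma max_eig_upper_tail (theta y c : R) (m : nat) : 0 < theta -> theta <= 1 / 4 ->
    (0 < m)%N -> k%:R <= theta ^+ 2 * m%:R ^+ 2 -> 1 < y ->
    y * p%:R <= (1 - 4 * theta) * c ->
  (P [set w | (c < max_eigX w)%R] <=
   ((n ^ k * (2 * m).+1 ^ k)%:R * expR (- (p%:R / 2) * (y - 1 - ln y)))%:E)%E.
Proof.
move=> th0 th4 m0 km y1 yc; have y0 : 0 < y by apply: lt_trans y1.
pose N (fg : {ffun 'I_k -> 'I_n} * {ffun 'I_k -> 'I_(2 * m).+1}) : R :=
  \sum_c gridvec fg.1 fg.2 c ^+ 2.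
pose t := 1 - y^-1.
have t0 : 0 < t by rewrite subr_gt0 invf_lt1.
have t1 : 1 - t = y^-1 by rewrite /t opprB addrC subrK.
pose F fg (x : 'I_p * 'I_n -> R) : R := if N fg == 0 then 0 else
  expR (- (t / 2 * y * p%:R)) * expR (t / N fg / 2 * quad (gridvec fg.1 fg.2) x).
have mF fg : jointly_measurable (F fg).
  rewrite /F; case: eqP => _; first exact: jointly_measurable_cst.
  by jmeas; exact: jointly_measurable_quad.
have F0 fg x : 0 <= F fg x.
  by rewrite /F; case: eqP => // _; rewrite mulr_ge0 ?expR_ge0.
have N0 fg : 0 <= N fg by apply: sumr_ge0 => ? _; exact: sqr_ge0.
have EF fg : (EX X (F fg) <= (expR (- (p%:R / 2) * (y - 1 - ln y)))%:E)%E.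
  rewrite /F; case: eqP => [_|/eqP Nn]; first by rewrite EX_cst lee_fin expR_ge0.
  have NN : 0 < N fg by rewrite lt_neqAle eq_sym Nn N0.
  have tE : t / N fg * N fg = t by rewrite divfK.
  rewrite EX_Zl ?expR_ge0//; last by jmeas; exact: jointly_measurable_quad.
  rewrite (EX_quad iidX (u := gridvec fg.1 fg.2) (t := t / N fg)) -/(N fg) tE; last first.
    by rewrite /t ltrBlDr ltrDl invr_gt0.
  rewrite t1 -EFinM -expRD lee_fin ler_expR lnV ?posrE//.
  by rewrite le_eqVlt; apply/orP; left; apply/eqP; rewrite /t; field; rewrite gt_eqF.
apply: (@le_trans _ _ (EX X (fun x => \sum_fg F fg x))).
  apply: probability_le_EX.
  - exact: measurable_max_eig_gt.
  - exact: jointly_measurable_sum.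
  - by move=> x; apply: sumr_ge0 => fg _; exact: F0.
  - move=> w /= ct.
    have [f [g [v0 h]]] := grid_net k0 kn (fun i => X i w) th0 th4 m0 km.
    rewrite (bigD1 (f, g))//= -[leLHS]addr0 lerD//; last by apply: sumr_ge0.
    rewrite /F /N /= gt_eqF// -expRD -[leLHS]expR0 ler_expR.
    set v := \sum_c _ in v0 h *; set q := quad _ _ in h *.
    rewrite (_ : - _ + _ = t / 2 * (q / v - y * p%:R)); last first.
      by field; rewrite gt_eqF.
    rewrite mulr_ge0 ?divr_ge0 ?(ltW t0)// subr_ge0 ler_pdivlMr//.
    apply: le_trans h; rewrite ler_pM2r//; apply: (le_trans yc).
    by rewrite ler_wpM2l ?(ltW ct)//; lra.
rewrite EX_sum//.
apply: (@le_trans _ _ (\sum_(fg : {ffun 'I_k -> 'I_n} * {ffun 'I_k -> 'I_(2 * m).+1})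
   (expR (- (p%:R / 2) * (y - 1 - ln y)))%:E)%E).
  by apply: lee_sum.
rewrite sumEFin lee_fin sumr_const cardT -cardE card_prod !card_ffun !card_ord.
by rewrite [leRHS]mulr_natl.
Qed.

End upper_tail.

(** * Counting pairs of k-sets by their overlap *)
Section counting.
Context (n k : nat).
Hypothesis kn : (k <= n)%N.

Lemma card_supersets_le (J : {set 'I_n}) : (#|J| <= k)%N ->
  (#|[set G : {set 'I_n} | (#|G| == k) && (J \subset G)]%SET| <= 'C(n - #|J|, k - #|J|))%N.
Proof.
move=> Jk; set A := [set G : {set 'I_n} | (#|G| == k) && (J \subset G)]%SET.
have inj : {in A &, injective (fun G => G :\: J)%SET}.
  move=> G H; rewrite !inE => /andP[_ JG] /andP[_ JH] GH.
  by rewrite -(finset.setID G J) -(finset.setID H J) GH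
     (finset.setIidPr JG) (finset.setIidPr JH).
rewrite -(card_in_imset inj).
have -> : (n - #|J| = #|~: J|)%N by rewrite [RHS]cardsCs finset.setCK card_ord.
rewrite -cards_draws; apply: subset_leq_card; apply/fintype.subsetP => _ /imsetP[G GA ->].
move: GA; rewrite !inE => /andP[/eqP Gk JG].
rewrite cardsD (finset.setIidPr JG) Gk eqxx andbT.
by apply/fintype.subsetP => c; rewrite !inE => /andP[].
Qed.

Lemma sum_powerset (R : realType) (f : nat -> R) (F : {set 'I_n}) :
  \sum_(J in powerset F) f #|J| = \sum_(r < #|F|.+1) 'C(#|F|, r)%:R * f r.
Proof.
pose h (J : {set 'I_n}) : 'I_#|F|.+1 := inord #|J|.
rewrite (partition_big h predT)//=; apply: eq_bigr => r _.
have -> : \sum_(i in powerset F | h i == r) f #|i| =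
    \sum_(i in [set J : {set 'I_n} | (J \subset F) && (#|J| == r)]%SET) f r.
  have hE (J : {set 'I_n}) : J \subset F -> (h J == r) = (#|J| == r).
    by move=> JF; rewrite -val_eqE /= inordK// ltnS subset_leq_card.
  apply: eq_big => [J|J]; rewrite !inE.
    by case: (boolP (J \subset F)) => //= /hE ->.
  by move=> /andP[JF]; rewrite hE// => /eqP ->.
by rewrite sumr_const cards_draws mulr_natl.
Qed.

(** Multiplying by (k - r) / (n - r) <= k / n at each step. *)
Lemma bin_sub_le (R : realType) (r : nat) : (r <= k)%N ->
  'C(n - r, k - r)%:R <= 'C(n, k)%:R * (k%:R / n%:R) ^+ r :> R.
Proof.
elim: r => [_|r IH rk]; first by rewrite !subn0 expr0 mulr1.
have rn : (r < n)%N by exact: leq_trans kn.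
have n0 : 0 < n%:R :> R by rewrite ltr0n (leq_trans _ rn).
have nr0 : 0 < (n - r)%:R :> R by rewrite ltr0n subn_gt0.
have E : ((n - r) * 'C(n - r.+1, k - r.+1) = (k - r) * 'C(n - r, k - r))%N.
  by rewrite !subnS mul_bin_diag prednK// subn_gt0.
have E' : 'C(n - r.+1, k - r.+1)%:R * (n - r)%:R = (k - r)%:R * 'C(n - r, k - r)%:R :> R.
  by rewrite -!natrM -E mulnC.
have kr : (k - r)%:R * n%:R <= k%:R * (n - r)%:R :> R.
  rewrite -!natrM ler_nat mulnBl mulnBr leq_sub2l//.
  by rewrite mulnC leq_mul2l kn orbT.
apply: (@le_trans _ _ ('C(n - r, k - r)%:R * (k%:R / n%:R))).
  rewrite -(ler_pM2r nr0) E' mulrC -mulrA ler_wpM2l//.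
  by rewrite mulrAC ler_pdivlMr.
rewrite exprSr [leRHS]mulrA ler_wpM2r ?divr_ge0//.
by apply: IH; exact: ltnW.
Qed.

(** Given F, group the G by J, their intersection with F, and bound the number of
    such G by the number of all the k-sets that include J. *)
Lemma sum_overlap_le (R : realType) (D : nat -> R) : (forall r, 0 <= D r) ->
  let K := [set G : {set 'I_n} | #|G| == k]%SET in
  \sum_(F in K) \sum_(G in K) D #|F :&: G| <=
  'C(n, k)%:R ^+ 2 * \sum_(r < k.+1) 'C(k, r)%:R * ((k%:R / n%:R) ^+ r * D r).
Proof.
move=> D0; pose K := [set G : {set 'I_n} | #|G| == k]%SET; rewrite -/K /=.
have Kc : #|K| = 'C(n, k) by rewrite card_draws card_ord.
have row F : F \in K -> \sum_(G in K) D #|F :&: G| <=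
    'C(n, k)%:R * \sum_(r < k.+1) 'C(k, r)%:R * ((k%:R / n%:R) ^+ r * D r).
  rewrite inE => /eqP Fk.
  rewrite (partition_big (fun G => F :&: G)%SET (mem (powerset F))) /=; last first.
    by move=> G _; rewrite inE finset.subsetIl.
  rewrite -[in leRHS]Fk.
  rewrite -(sum_powerset (fun r => (#|F|%:R / n%:R) ^+ r * D r)) Fk mulr_sumr.
  apply: ler_sum => J; rewrite inE => JF; rewrite mulrA.
  have Jk : (#|J| <= k)%N by rewrite -Fk subset_leq_card.
  apply: (@le_trans _ _ 
    (\sum_(G in [set G : {set 'I_n} | (#|G| == k) && (J \subset G)]%SET) D #|J|)).
    rewrite [leRHS]big_mkcond [leLHS]big_mkcond; apply: ler_sum => G _.
    rewrite !inE; case: eqP => //= _.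
    case: eqP => [<-|_]; first by rewrite finset.subsetIr.
    by case: ifP.
  rewrite sumr_const -[leLHS]mulr_natl ler_wpM2r//.
  apply: (@le_trans _ _ 'C(n - #|J|, k - #|J|)%:R); last exact: bin_sub_le.
  by rewrite ler_nat card_supersets_le.
apply: (le_trans (ler_sum _ row)).
by rewrite sumr_const Kc expr2 -[leLHS]mulr_natl -mulrA.
Qed.
End counting.

(** * Lower tail by a truncated second moment *)
Section lower_tail.
Context {R : realType} (p n k : nat) (d : measure_display) (T : measurableType d).
Context (P : probability T R) (X : 'I_p * 'I_n -> {RV P >-> R}).
Hypotheses (k0 : (0 < k)%N) (kn : (k <= n)%N).
Hypothesis iidX : iid_with_law X (normal_prob 0 1).
Context (l delta : R).
Hypotheses (l1 : 1 < l) (d0 : 0 < delta) (d1 : delta < 1).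
Local Notation EX := (EX X).
Implicit Types (F G J : {set 'I_n}) (x : 'I_p * 'I_n -> R).

(** The variance, in one row and under the law tilted by [lratio F], of the
    normalized sum of [r] of the [k] columns of F. *)
Definition tilted_variance (r : nat) : R := 1 + (l - 1) * (r%:R / k%:R).
Local Notation lr := tilted_variance.
(* The factor k accounts for column sums that are not normalized. *)
Let t : R := (1 - l^-1) / k%:R.
(** For small [delta] this is about exp(p g(l_r) / 2), with l_r the tilted variance
    and g(x) = x - ln x - 1. *)
Definition overlap_bound (r : nat) : R :=
  expR (p%:R / 2 * ((lr r - 1) * (1 + delta) - ln (lr r))).

Let k1 : 0 < k%:R :> R. Proof. by rewrite ltr0n. Qed.
Let l0 : 0 < l. Proof. by apply: lt_trans l1. Qed.
Let lr_gt0 r : 0 < lr r.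
Proof. by rewrite ltr_pwDl// mulr_ge0 ?divr_ge0// subr_ge0 ltW. Qed.

(** The likelihood ratio that gives variance [l] to the normalized sum of the
    columns of F, in all rows, and leaves the orthogonal directions alone. *)
Definition lratio F x : R := expR (- (p%:R / 2 * ln l)) * expR (t / 2 * sqcolsum F x).

(** At least 1 when the sum over J exceeds its typical size under the tilted law by
    a factor 1 + delta. The rate is the optimal one in the Chernoff bound. *)
Let upper_pen J x : R := expR (- (p%:R / 2 * delta)) *
  expR (delta / (1 + delta) / (#|J|%:R * lr #|J|) / 2 * sqcolsum J x).

(** At least 1 when the sum over F is below its typical size under the tilted law by
    a factor 1 - delta. *)
Let lower_pen F x : R := expR (p%:R / 2 * delta) *
  expR (- (delta / (1 - delta) / (k%:R * l)) / 2 * sqcolsum F x).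

(** Dominates the product of the truncated likelihood ratios: the last factor is at
    least 1 when the sum over the common columns is not too large. Its rate
    (l - 1) / (k l_r) is half of what the two ratios contribute to the exponent
    of the common columns, which is optimal to leading order in [delta]. *)
Let overlap_dom F G x : R :=
  lratio F x * lratio G x * (expR (p%:R / 2 * ((lr #|F :&: G| - 1) * (1 + delta))) *
    expR (- ((l - 1) / (k%:R * lr #|F :&: G|)) / 2 * sqcolsum (F :&: G) x)).

Let card_setD F J : #|F| = k -> J \subset F -> #|F :\: J|%:R = k%:R - #|J|%:R :> R.
Proof.
by move=> Fk JF; rewrite cardsDS// Fk natrB// -Fk subset_leq_card.
Qed.

Let tE r : 1 - t * (k%:R - r%:R) = lr r / l.
Proof. by rewrite /t /tilted_variance; field; rewrite !gt_eqF. Qed.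

Let aE r : t / (lr r / l) = (l - 1) / (k%:R * lr r).
Proof. by rewrite /t; field; rewrite !gt_eqF. Qed.

Let ar r : (l - 1) / (k%:R * lr r) * r%:R = 1 - (lr r)^-1.
Proof.
have : (l - 1) * r%:R = k%:R * (lr r - 1).
  by rewrite /tilted_variance; field; rewrite gt_eqF.
move=> h; rewrite mulrAC h; field; by rewrite !gt_eqF.
Qed.

Let t_lt1 r : t * (k%:R - r%:R) < 1.
Proof. by rewrite -subr_gt0 tE divr_gt0. Qed.

Let lr_full : lr k = l.
Proof. by rewrite /tilted_variance divff ?gt_eqF// mulr1 addrC subrK. Qed.

Let mexpq (c : R) J : jointly_measurable (fun x => expR (c * sqcolsum J x)).
Proof. by jmeas; exact: jointly_measurable_sqcolsum. Qed.

Let mlratio F : jointly_measurable (lratio F).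
Proof. by rewrite /lratio; jmeas; exact: mexpq. Qed.

Let lratio_gt0 F x : 0 < lratio F x.
Proof. by rewrite mulr_gt0 ?expR_gt0. Qed.

(** Under the tilted law the normalized sum over J has variance l_r, which explains
    the factor [lr #|J|] in the Laplace transform. *)
Lemma EX_lratio_tilt F J (s : R) : #|F| = k -> J \subset F ->
    s * #|J|%:R * lr #|J| < 1 ->
  EX (fun x => lratio F x * expR (s / 2 * sqcolsum J x)) =
  (expR (- (p%:R / 2 * ln (1 - s * #|J|%:R * lr #|J|))))%:E.
Proof.
move=> Fk JF sJ; set r := #|J| in sJ *.
have FJ : F :&: J = J by apply/finset.setIidPr.
have JF0 : J :\: F = finset.set0 by apply/eqP; rewrite finset.setD_eq0.
have E1 : 1 - (t / (lr r / l) + 0 + s) * r%:R = (1 - s * r%:R * lr r) / lr r.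
  by rewrite addr0 mulrDl aE ar; field; rewrite gt_eqF.
have h1 : t * #|F :\: J|%:R < 1 by rewrite card_setD// t_lt1.
have h2 : 0 * #|J :\: F|%:R < 1 :> R by rewrite mul0r ltr01.
have h3 : (t / (1 - t * #|F :\: J|%:R) + 0 / (1 - 0 * #|J :\: F|%:R) + s) * #|F :&: J|%:R < 1.
  by rewrite -subr_gt0 card_setD// tE FJ mul0r -/r E1 divr_gt0// subr_gt0.
have := EX_overlap iidX h1 h2 h3.
rewrite card_setD// tE !mul0r FJ -/r E1 subr0 ln1 addr0 => H.
transitivity (EX (fun x => expR (- (p%:R / 2 * ln l)) *
    expR (t / 2 * sqcolsum F x + 0 * sqcolsum J x + s / 2 * sqcolsum J x))).
  congr (EX _); apply/funext => x.
  by rewrite /lratio -mulrA -expRD mul0r addr0.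
rewrite EX_Zl ?expR_ge0//; last first.
  by jmeas; exact: jointly_measurable_sqcolsum.
rewrite H -EFinM -expRD !ln_div ?posrE ?subr_gt0//.
by congr (expR _)%:E; field.
Qed.

Lemma EX_lratio F : #|F| = k -> EX (lratio F) = 1%:E.
Proof.
move=> Fk; have := @EX_lratio_tilt F F 0 Fk (fintype.subxx _).
rewrite !mul0r subr0 ln1 mulr0 oppr0 expR0 => <- //; congr (EX _); apply/funext => x.
by rewrite mul0r expR0 mulr1.
Qed.

Let EX_upper_pen F J : #|F| = k -> J \subset F -> J != finset.set0 ->
  EX (fun x => lratio F x * upper_pen J x) =
  (expR (- (p%:R / 2 * (delta - ln (1 + delta)))))%:E.
Proof.
move=> Fk JF J0; have J1 : 0 < #|J|%:R :> R by rewrite ltr0n card_gt0.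
set s := delta / (1 + delta) / (#|J|%:R * lr #|J|).
have dp : 0 < 1 + delta by rewrite addr_gt0.
have sE : s * #|J|%:R * lr #|J| = delta / (1 + delta).
  by rewrite /s; field; rewrite !gt_eqF.
have sE1 : 1 - delta / (1 + delta) = (1 + delta)^-1 by field; rewrite gt_eqF.
have s1 : s * #|J|%:R * lr #|J| < 1 by rewrite sE -subr_gt0 sE1 invr_gt0.
transitivity (EX (fun x => expR (- (p%:R / 2 * delta)) *
    (lratio F x * expR (s / 2 * sqcolsum J x)))).
  by congr (EX _); apply/funext => x; rewrite mulrCA.
rewrite EX_Zl ?expR_ge0//; last 2 first.
- by apply: jointly_measurableM; [exact: mlratio|exact: mexpq].
- by move=> x; rewrite mulr_ge0 ?expR_ge0// ltW.
rewrite EX_lratio_tilt// sE sE1 -EFinM -expRD lnV ?posrE//.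
by congr (expR _)%:E; ring.
Qed.

Let EX_lower_pen F : #|F| = k ->
  EX (fun x => lratio F x * lower_pen F x) =
  (expR (p%:R / 2 * (delta + ln (1 - delta))))%:E.
Proof.
move=> Fk; set s := - (delta / (1 - delta) / (k%:R * l)).
have dp : 0 < 1 - delta by rewrite subr_gt0.
have sE : s * #|F|%:R * lr #|F| = - (delta / (1 - delta)).
  by rewrite /s Fk lr_full; field; rewrite !gt_eqF.
have sE1 : 1 - - (delta / (1 - delta)) = (1 - delta)^-1 by field; rewrite gt_eqF.
have s1 : s * #|F|%:R * lr #|F| < 1 by rewrite sE -subr_gt0 sE1 invr_gt0.
transitivity (EX (fun x => expR (p%:R / 2 * delta) *
    (lratio F x * expR (s / 2 * sqcolsum F x)))).
  by congr (EX _); apply/funext => x; rewrite mulrCA.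
rewrite EX_Zl ?expR_ge0//; last 2 first.
- by apply: jointly_measurableM; [exact: mlratio|exact: mexpq].
- by move=> x; rewrite mulr_ge0 ?expR_ge0// ltW.
rewrite EX_lratio_tilt// sE sE1 -EFinM -expRD lnV ?posrE//.
by congr (expR _)%:E; ring.
Qed.

Let EX_overlap_dom F G : #|F| = k -> #|G| = k ->
  EX (overlap_dom F G) = (overlap_bound #|F :&: G|)%:E.
Proof.
move=> Fk Gk; set r := #|F :&: G|; set a := (l - 1) / (k%:R * lr r).
have FG : #|F :\: G|%:R = k%:R - r%:R :> R.
  by rewrite cardsD Fk natrB// -Fk subset_leq_card// finset.subsetIl.
have GF : #|G :\: F|%:R = k%:R - r%:R :> R.
  by rewrite cardsD Gk finset.setIC natrB// -Fk subset_leq_card// finset.subsetIl.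
have E1 : 1 - (a + a + - a) * r%:R = (lr r)^-1.
  by rewrite addrK ar opprB addrC subrK.
have h1 : t * #|F :\: G|%:R < 1 by rewrite FG t_lt1.
have h2 : t * #|G :\: F|%:R < 1 by rewrite GF t_lt1.
have h3 : (t / (1 - t * #|F :\: G|%:R) + t / (1 - t * #|G :\: F|%:R) + - a) * #|F :&: G|%:R < 1.
  by rewrite FG GF tE aE -/a -subr_gt0 -/r E1 invr_gt0.
have := EX_overlap iidX h1 h2 h3; rewrite FG GF tE aE -/a -/r E1 => H.
pose c := expR (- (p%:R * ln l) + p%:R / 2 * ((lr r - 1) * (1 + delta))).
transitivity (EX (fun x => c *
    expR (t / 2 * sqcolsum F x + t / 2 * sqcolsum G x + - a / 2 * sqcolsum (F :&: G) x))).
  congr (EX _); apply/funext => x; rewrite /overlap_dom /lratio -/r -/a /c -!expRD.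
  by congr expR; field.
rewrite EX_Zl ?expR_ge0//; last by jmeas; exact: jointly_measurable_sqcolsum.
rewrite H -EFinM -expRD !ln_div ?lnV ?posrE//; congr (expR _)%:E.
by field.
Qed.

(** Let W_F be the truncated likelihood ratio, M the number of k-sets and y the mean
    of the W_F. On the event of the statement y = 0, and 2 y <= 1 + y^2 always
    holds, so that P(A) + 2 E y <= 1 + E y^2: a form of Chebyshev's inequality
    without subtraction. The mean of the W_F is 1 up to the penalties, the first
    two terms of the bound, and E y^2 is at most 1 plus the third. *)
Lemma max_eig_lower_tail :
  (P [set w | (max_eig k (fun i => X i w) < p%:R * (l * (1 - delta)))%R] <=
   (2 * (2 ^ k)%:R * expR (- (p%:R / 2 * (delta - ln (1 + delta)))) +
    2 * expR (p%:R / 2 * (delta + ln (1 - delta))) +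
    \sum_(r < k) 'C(k, r.+1)%:R * ((k%:R / n%:R) ^+ r.+1 * overlap_bound r.+1))%:E)%E.
Proof.
pose K := [set F : {set 'I_n} | #|F| == k]%SET.
have KE F : F \in K -> #|F| = k by rewrite inE => /eqP.
pose M : R := 'C(n, k)%:R.
have M0 : 0 < M by rewrite ltr0n bin_gt0.
have KM : #|K|%:R = M by rewrite card_draws card_ord.
pose pen F x := (\sum_(J : {set 'I_n} | (J \subset F) && (J != finset.set0))
  lratio F x * upper_pen J x) + lratio F x * lower_pen F x.
pose G1 x := 2 / M * \sum_(F in K) lratio F x.
pose G2 x := 1 + (2 / M * \sum_(F in K) pen F x) +
  M^-2 * \sum_(F in K) \sum_(G in K) overlap_dom F G x.
have lr0 F x : 0 <= lratio F x by exact: ltW.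
have up0 J x : 0 <= upper_pen J x by rewrite mulr_ge0 ?expR_ge0.
have lp0 F x : 0 <= lower_pen F x by rewrite mulr_ge0 ?expR_ge0.
have pen0 F x : 0 <= pen F x by rewrite addr_ge0 ?sumr_ge0// => *; rewrite mulr_ge0.
have od0 F G x : 0 <= overlap_dom F G x.
  by rewrite /overlap_dom !mulr_ge0 ?expR_ge0.
have mup J : jointly_measurable (upper_pen J).
  by apply: jointly_measurableM; [exact: jointly_measurable_cst|exact: mexpq].
have mlp F : jointly_measurable (lower_pen F).
  by apply: jointly_measurableM; [exact: jointly_measurable_cst|exact: mexpq].
have mpen F : jointly_measurable (pen F).
  apply: jointly_measurableD; last by apply: jointly_measurableM.
  by apply: jointly_measurable_sum => J; apply: jointly_measurableM.
have mod F G : jointly_measurable (overlap_dom F G).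
  apply: jointly_measurableM; first by apply: jointly_measurableM.
  by apply: jointly_measurableM; [exact: jointly_measurable_cst|exact: mexpq].
have mG1 : jointly_measurable G1.
  apply: jointly_measurableM; first exact: jointly_measurable_cst.
  exact: jointly_measurable_sum.
have mG2a : jointly_measurable (fun x => 2 / M * \sum_(F in K) pen F x).
  apply: jointly_measurableM; first exact: jointly_measurable_cst.
  exact: jointly_measurable_sum.
have mG2b : jointly_measurable (fun x => M^-2 * \sum_(F in K) \sum_(G in K) overlap_dom F G x).
  apply: jointly_measurableM; first exact: jointly_measurable_cst.
  by apply: jointly_measurable_sum => F; exact: jointly_measurable_sum.
have sqM0 : 0 <= M^-2 by rewrite invr_ge0 sqr_ge0.
have twoM0 : 0 <= 2 / M by rewrite divr_ge0// ltW.
have G10 x : 0 <= G1 x by rewrite mulr_ge0// sumr_ge0.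
have G2a0 x : 0 <= 2 / M * \sum_(F in K) pen F x by rewrite mulr_ge0// sumr_ge0.
have G2b0 x : 0 <= M^-2 * \sum_(F in K) \sum_(G in K) overlap_dom F G x.
  by rewrite mulr_ge0// sumr_ge0// => F _; rewrite sumr_ge0.
have mG2 : jointly_measurable G2.
  apply: jointly_measurableD => //; apply: jointly_measurableD => //.
have G20 x : 0 <= G2 x by rewrite !addr_ge0.
pose b1 := expR (- (p%:R / 2 * (delta - ln (1 + delta)))).
pose b0 := expR (p%:R / 2 * (delta + ln (1 - delta))).
have EG1 : EX G1 = 2%:E.
  rewrite EX_Zl//; last 2 first.
  - exact: jointly_measurable_sum.
  - by move=> x; rewrite sumr_ge0.
  rewrite EX_sum_cond// (eq_bigr (fun=> 1%:E)) => [|F /KE /EX_lratio//].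
  by rewrite sumEFin sumr_const KM -EFinM divfK// gt_eqF.
have Epen F : F \in K -> (EX (pen F) <= ((2 ^ k)%:R * b1 + b0)%:E)%E.
  move=> /KE Fk; rewrite EX_add; last 4 first.
  - by apply: jointly_measurable_sum => J; apply: jointly_measurableM.
  - by move=> x; rewrite sumr_ge0// => J _; rewrite mulr_ge0.
  - by apply: jointly_measurableM.
  - by move=> x; rewrite mulr_ge0.
  rewrite EX_lower_pen// EX_sum_cond; last 2 first.
  - by move=> J; apply: jointly_measurableM.
  - by move=> J x; rewrite mulr_ge0.
  rewrite (eq_bigr (fun=> b1%:E)) => [|J /andP[JF J0]]; last exact: EX_upper_pen.
  rewrite sumEFin -EFinD lee_fin lerD2r.
  rewrite -{1}Fk -card_powerset mulr_natl -sumr_const big_mkcond [leRHS]big_mkcond.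
  apply: ler_sum => J _; rewrite inE; case: (J \subset F) => //=.
  by case: ifP => // _; exact: expR_ge0.
have EG2 : (EX G2 <= (1 + (2 * ((2 ^ k)%:R * b1 + b0)) + (1 +
   \sum_(r < k) 'C(k, r.+1)%:R * ((k%:R / n%:R) ^+ r.+1 * overlap_bound r.+1)))%:E)%E.
  rewrite EX_add//; last 2 first.
  - by apply: jointly_measurableD => //; exact: jointly_measurable_cst.
  - by move=> x; rewrite addr_ge0.
  rewrite EX_add//.
  rewrite EX_cst !EFinD leeD//.
  - rewrite leeD2l// EX_Zl//; last 2 first.
    + exact: jointly_measurable_sum.
    + by move=> x; rewrite sumr_ge0.
    rewrite EX_sum_cond//.
    apply: (@le_trans _ _ ((2 / M)%:E * \sum_(F in K) ((2 ^ k)%:R * b1 + b0)%:E)%E).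
      by rewrite lee_wpmul2l ?lee_fin//; apply: lee_sum.
    rewrite sumEFin sumr_const -EFinM lee_fin -[X in _ / M * X]mulr_natl KM.
    by rewrite mulrA divfK ?gt_eqF.
  - rewrite EX_Zl//; last 2 first.
    + by apply: jointly_measurable_sum => F; exact: jointly_measurable_sum.
    + by move=> x; rewrite sumr_ge0// => F _; rewrite sumr_ge0.
    rewrite EX_sum_cond//; last 2 first.
    + by move=> F; exact: jointly_measurable_sum.
    + by move=> F x; rewrite sumr_ge0.
    rewrite (eq_bigr (fun F => (\sum_(G in K) overlap_bound #|F :&: G|)%:E)); last first.
      move=> F FK; rewrite EX_sum_cond// -sumEFin; apply: eq_bigr => G GK.
      by rewrite EX_overlap_dom// KE.
    rewrite sumEFin -EFinM -EFinD lee_fin mulrC ler_pdivrMr ?exprn_gt0//.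
    have ob0 r : 0 <= overlap_bound r by exact: expR_ge0.
    apply: (le_trans (sum_overlap_le kn ob0)).
    rewrite mulrC ler_wpM2r ?sqr_ge0// big_ord_recl /= bin0 expr0 !mul1r lerD2r.
    rewrite /overlap_bound /tilted_variance mul0r mulr0 addr0 subrr mul0r ln1 subr0 mulr0.
    by rewrite expR0.
(* The inequality P(A) + 2 E y <= 1 + E y^2 before integration, with the W_F
   replaced by exponentials. *)
have key w : \1_[set w | max_eig k (fun i => X i w) < p%:R * (l * (1 - delta))] w +
    G1 (fun i => X i w) <= G2 (fun i => X i w).
  set x := (fun i => X i w).
  pose ok F := [forall (J : {set 'I_n} | J \subset F),
      sqcolsum J x <= p%:R * (#|J|%:R * lr #|J|) * (1 + delta)] &&
    (p%:R * (k%:R * l) * (1 - delta) <= sqcolsum F x).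
  pose W F := if ok F then lratio F x else 0.
  have W0 F : 0 <= W F by rewrite /W; case: ifP.
  (* If the truncation fails, one of the penalties is at least 1. *)
  have lrW F : F \in K -> lratio F x <= W F + pen F x.
    move=> /KE Fk; rewrite /W; case: (boolP (ok F)) => [_|]; first by rewrite lerDl.
    rewrite add0r /ok negb_and => /orP[/forallPn[J]|].
      rewrite negb_imply -ltNge => /andP[JF sJ].
      have J0 : J != finset.set0.
        apply: contraTneq sJ => ->; rewrite cards0 mul0r mulr0 mul0r.
        by rewrite /sqcolsum big1 ?ltxx// => r _; rewrite /colsum big_set0 expr0n.
      have J1 : 0 < #|J|%:R :> R by rewrite ltr0n card_gt0.
      rewrite /pen (bigD1 J) ?JF//= -addrA -[leLHS]addr0 lerD//; last first.
        by rewrite addr_ge0 ?mulr_ge0// sumr_ge0// => ? _; rewrite mulr_ge0.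
      rewrite ler_peMr// /upper_pen -expRD -[leLHS]expR0 ler_expR.
      set q := sqcolsum J x in sJ *.
      have := lr_gt0 #|J|; set m := lr _ in sJ * => m0.
      have -> : - (p%:R / 2 * delta) + delta / (1 + delta) / (#|J|%:R * m) / 2 * q =
         delta / (1 + delta) / (#|J|%:R * m) / 2 *
         (q - p%:R * (#|J|%:R * m) * (1 + delta)).
        by field; rewrite !gt_eqF// addr_gt0.
      rewrite mulr_ge0// ?subr_ge0 ?(ltW sJ)// !divr_ge0// ?(ltW d0)//.
        by rewrite addr_ge0// ltW.
      by rewrite mulr_ge0// ltW.
    rewrite -ltNge => sF.
    rewrite -[leLHS]add0r lerD//; first by rewrite sumr_ge0// => ? _; rewrite mulr_ge0.
    rewrite ler_peMr// /lower_pen -expRD -[leLHS]expR0 ler_expR.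
    set q := sqcolsum F x in sF *.
    have dp : 0 < 1 - delta by rewrite subr_gt0.
    have -> : p%:R / 2 * delta + - (delta / (1 - delta) / (k%:R * l)) / 2 * q =
       delta / (1 - delta) / (k%:R * l) / 2 *
         (p%:R * (k%:R * l) * (1 - delta) - q).
      by field; rewrite !gt_eqF.
    rewrite mulr_ge0// ?subr_ge0 ?(ltW sF)// !divr_ge0// ?(ltW d0) ?(ltW dp)//.
    by rewrite mulr_ge0// ltW.
  have WW F G : F \in K -> G \in K -> W F * W G <= overlap_dom F G x.
    move=> FK GK; rewrite /W; case: (boolP (ok F)) => [okF|_]; last by rewrite mul0r.
    case: (boolP (ok G)) => [okG|_]; last by rewrite mulr0.
    rewrite /overlap_dom ler_peMr ?mulr_ge0// -expRD -[leLHS]expR0 ler_expR.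
    move: okF => /andP[/forallP/(_ (F :&: G)%SET)/implyP/(_ (finset.subsetIl _ _)) sJ _].
    set q := sqcolsum _ _ in sJ *; set r := #|_| in sJ *.
    have -> : p%:R / 2 * ((lr r - 1) * (1 + delta)) + - ((l - 1) / (k%:R * lr r)) / 2 * q =
       (l - 1) / (k%:R * lr r) / 2 * (p%:R * (r%:R * lr r) * (1 + delta) - q).
      have -> : lr r - 1 = (l - 1) / (k%:R * lr r) * (r%:R * lr r).
        by rewrite mulrA ar mulrBl mul1r mulVf// gt_eqF.
      by move: ((l - 1) / (k%:R * lr r)) => c; field.
    by rewrite mulr_ge0 ?subr_ge0// !divr_ge0// ?mulr_ge0 ?subr_ge0 ?ltW.
  pose y := M^-1 * \sum_(F in K) W F.
  have y0 : 0 <= y by rewrite mulr_ge0 ?invr_ge0 ?(ltW M0)// sumr_ge0.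
  have G1y : G1 x <= 2 * y + 2 / M * \sum_(F in K) pen F x.
    rewrite /y mulrA -mulrDr ler_wpM2l// -big_split; exact: ler_sum.
  have y2 : y ^+ 2 <= M^-2 * \sum_(F in K) \sum_(G in K) overlap_dom F G x.
    rewrite /y exprMn exprVn ler_wpM2l// expr2 big_distrlr /=.
    by apply: ler_sum => F FK; apply: ler_sum => G GK; exact: WW.
  have Ay : \1_[set w | max_eig k (fun i => X i w) < p%:R * (l * (1 - delta))] w +
      2 * y <= 1 + y ^+ 2.
    rewrite indicE; case: (boolP (w \in _)) => [|_]; last first.
      rewrite /= add0r -subr_ge0 (_ : _ - _ = (y - 1) ^+ 2) ?sqr_ge0//; ring.
    rewrite inE /= -/x => tx.
    have -> : y = 0.
      rewrite /y big1 ?mulr0// => F /KE Fk; rewrite /W; case: ifP => // /andP[_ sF].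
      exfalso; move: sF; apply/negP; rewrite -ltNge.
      pose u (c : 'I_n) : R := (c \in F)%:R.
      have uF : {in ~: F, forall c, u c = 0}%SET by move=> c; rewrite inE /u => /negbTE ->.
      have qE : quad u x = sqcolsum F x.
        apply: eq_bigr => r _; congr (_ ^+ 2); rewrite /colsum [RHS]big_mkcond.
        by apply: eq_bigr => c _; rewrite /u; case: ifP => _; rewrite ?mul1r ?mul0r.
      have uE : \sum_c u c ^+ 2 = k%:R.
        rewrite -Fk -sum1_card natr_sum [RHS]big_mkcond; apply: eq_bigr => c _.
        by rewrite /u; case: ifP => _; rewrite ?expr1n ?expr0n.
      have := quad_le_max_eig k0 kn x Fk uF; rewrite qE uE => h; apply: (le_lt_trans h).
      have -> : p%:R * (k%:R * l) * (1 - delta) = p%:R * (l * (1 - delta)) * k%:R by ring.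
      by rewrite ltr_pM2r.
    by rewrite mulr0 expr0n addr0.
  rewrite /G2; move: G1y y2 Ay; lra.
have mA := measurable_max_eig_lt X k0 kn (p%:R * (l * (1 - delta))).
have := le_trans (probability_add_EX_le mA mG1 G10 mG2 G20 key) EG2.
rewrite EG1 -(fineK (fin_num_measure P _ mA)) -EFinD !lee_fin.
by rewrite -/b1 -/b0; set S := \sum_(_ < _) _; set a := fine _; set e := _%:R; lra.
Qed.

End lower_tail.

(** * The rate function *)
Section rate_function.
Context {R : realType}.
Implicit Types x y v : R.

(** Twice the large deviation rate of the chi-squared law. *)
Definition rate x : R := x - ln x - 1.

Lemma ln_lt_sub1 x : 0 < x -> x != 1 -> ln x < x - 1.
Proof.
move=> x0 x1; rewrite ltrBrDl -[X in _ < X](@lnK R x) ?posrE//.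
by apply: expR_gt1Dx; rewrite ln_eq0.
Qed.

Lemma ln_le_sub1 x : 0 < x -> ln x <= x - 1.
Proof.
move=> x0; have [->|x1] := eqVneq x 1; first by rewrite ln1 subrr.
by rewrite ltW// ln_lt_sub1.
Qed.

Lemma rate_lt x y : 1 <= x -> x < y -> rate x < rate y.
Proof.
move=> x1 xy; have x0 : 0 < x by exact: lt_le_trans x1.
have y0 : 0 < y by exact: lt_trans xy.
have yx : y / x != 1.
  apply: contraTneq xy => /(congr1 ( *%R^~ x)).
  by rewrite divfK ?gt_eqF// mul1r => ->; rewrite ltxx.
have := ln_lt_sub1 (divr_gt0 y0 x0) yx.
rewrite ln_div ?posrE// => h.
have : y / x - 1 <= y - x.
  rewrite (_ : y / x - 1 = (y - x) / x); last by field; rewrite gt_eqF.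
  by rewrite ler_pdivrMr// ler_peMr// subr_ge0 ltW.
by rewrite /rate; move: h; lra.
Qed.

Lemma rate1 : rate 1 = 0. Proof. by rewrite /rate ln1 subr0 subrr. Qed.

Lemma rate_gt0 x : 1 < x -> 0 < rate x.
Proof. by move=> x1; rewrite -rate1; apply: rate_lt. Qed.

(** The bound ln b <= b/2 makes the rate unbounded; then the intermediate value
    theorem applies. *)
Lemma rate_root v : 0 < v -> exists2 x, 1 < x & rate x = v.
Proof.
move=> v0; pose b := 2 * (v + 1).
have b1 : 1 <= b by rewrite /b; lra.
have rb : v <= rate b.
  have b0 : 0 < b / 2 by rewrite /b mulrC mulKf//; lra.
  have : ln b <= b / 2.
    have -> : b = 2 * (b / 2) by field.
    rewrite lnM ?posrE//; have := ln_le_sub1 b0; have := @ln_le_sub1 2 ltac:(by []).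
    have -> : 2 * (b / 2) / 2 = b / 2 by field.
    lra.
  by rewrite /rate /b; lra.
have c : {within `[1, b], continuous rate}.
  apply: continuous_in_subspaceT => x; rewrite inE /= in_itv /= => /andP[x1 _].
  have x0 : 0 < x by exact: lt_le_trans x1.
  apply: cvgB; last exact: cvg_cst.
  by apply: cvgB; [exact: cvg_id|exact: continuous_ln].
have [|x xb xv] := IVT b1 c (v := v); last first.
- exists x => //; move: xb; rewrite in_itv /= => /andP[x1 _].
  rewrite lt_neqAle x1 andbT; apply: contraTneq v0 => x1'.
  by rewrite -xv -x1' rate1 ltxx.
- rewrite rate1 ge_min le_max rb (ltW v0) /=.
  by rewrite orbT.
Qed.

(** Concavity of ln between 1 and x, from ln z <= z - 1 at z = x / y and z = 1 / y. *)
Lemma ln_interpolation x (rho : R) : 1 < x -> 0 <= rho -> rho <= 1 ->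
  rho * ln x <= ln (1 + (x - 1) * rho).
Proof.
move=> x1 r0 r1; have x0 : 0 < x by exact: lt_trans x1.
set y := 1 + _; have y0 : 0 < y by rewrite ltr_pwDl// mulr_ge0// subr_ge0 ltW.
have h1 := ln_le_sub1 (divr_gt0 x0 y0); rewrite ln_div ?posrE// in h1.
have yi : 0 < y^-1 by rewrite invr_gt0.
have h2 := ln_le_sub1 yi; rewrite lnV ?posrE// in h2.
have : rho * (ln x - ln y) + (1 - rho) * (- ln y) <=
  rho * (x / y - 1) + (1 - rho) * (y^-1 - 1).
  by rewrite lerD// ler_wpM2l// subr_ge0.
have -> : rho * (x / y - 1) + (1 - rho) * (y^-1 - 1) = 0.
  rewrite (_ : _ + _ = (1 + (x - 1) * rho) / y - 1);
    [by rewrite divff ?gt_eqF// subrr|by field; rewrite gt_eqF].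
lra.
Qed.

End rate_function.

(** * Asymptotics in the regime p ~ beta ln n *)
Section asymptotics.
Context {R : realType}.

Lemma near_ln_gt (M : R) : \forall n \near \oo, M < ln (n%:R : R).
Proof.
near=> n.
have h : expR M < n%:R by near: n; exact: nbhs_infty_gtr.
by rewrite -[X in X < _](@expRK R) ltr_ln// posrE ?expR_gt0// (lt_trans _ h) ?expR_gt0.
Unshelve. all: by end_near. Qed.

Lemma expR_cvg0 (a : nat -> R) (c g : R) : 0 < g ->
    (\forall n \near \oo, a n <= c - g * ln (n%:R : R)) ->
  expR (a n) @[n --> \oo] --> 0.
Proof.
move=> g0 h; apply/cvgr0Pnorm_lt => e e0; near=> n.
rewrite gtr0_norm ?expR_gt0// -[X in _ < X](@lnK R e) ?posrE// ltr_expR.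
have h1 : a n <= c - g * ln n%:R by near: n.
have h2 : (c - ln e) / g < ln (n%:R : R) by near: n; exact: near_ln_gt.
by rewrite ltr_pdivrMr// in h2; lra.
Unshelve. all: by end_near. Qed.

Context (beta : R) (p : nat -> nat).
Hypothesis beta0 : 0 < beta.
Hypothesis hp : (p n)%:R / ln (n%:R : R) @[n --> \oo] --> beta.

Lemma near_p_ge (b : R) : b < beta ->
  \forall n \near \oo, b * ln (n%:R : R) <= (p n)%:R.
Proof.
move=> bb; near=> n.
have l0 : 0 < ln (n%:R : R) by near: n; exact: near_ln_gt.
by rewrite -ler_pdivlMr// ltW//; near: n; exact: (cvgr_gt beta).
Unshelve. all: by end_near. Qed.

Lemma near_p_le (b : R) : beta < b ->
  \forall n \near \oo, (p n)%:R <= b * ln (n%:R : R).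
Proof.
move=> bb; near=> n.
have l0 : 0 < ln (n%:R : R) by near: n; exact: near_ln_gt.
by rewrite -ler_pdivrMr// ltW//; near: n; exact: (cvgr_lt beta).
Unshelve. all: by end_near. Qed.

Lemma half_beta_lt : beta / 2 < beta.
Proof. by rewrite ltr_pdivrMr// ltr_pMr// ltr1n. Qed.

Lemma near_p_gt0 : \forall n \near \oo, (0 < p n)%N.
Proof.
near=> n; rewrite -(ltr_nat R).
have l0 : 0 < ln (n%:R : R) by near: n; exact: near_ln_gt.
apply: (@lt_le_trans _ _ (beta / 2 * ln n%:R)); first by rewrite !mulr_gt0.
by near: n; exact: near_p_ge half_beta_lt.
Unshelve. all: by end_near. Qed.

Lemma expR_p_cvg0 (c : R) : 0 < c -> expR (- ((p n)%:R / 2 * c)) @[n --> \oo] --> 0.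
Proof.
move=> c0; apply: (@expR_cvg0 _ 0 (beta / 4 * c)); first by rewrite !mulr_gt0.
near=> n.
have : beta / 2 * ln (n%:R : R) <= (p n)%:R by near: n; exact: near_p_ge half_beta_lt.
nra.
Unshelve. all: by end_near. Qed.

Lemma upper_bound_cvg0 (k m : nat) (y : R) : 1 < y -> 2 * k%:R / beta < rate y ->
  (n ^ k * m.+1)%:R * expR (- ((p n)%:R / 2) * (y - 1 - ln y)) @[n --> \oo] --> 0.
Proof.
move=> y1 ky; have r0 := rate_gt0 y1.
rewrite ltr_pdivrMr// in ky.
pose g := (rate y * beta / 2 - k%:R) / 2.
have g0 : 0 < g by rewrite /g; lra.
have bb : 2 * (k%:R + g) / rate y < beta.
  by rewrite ltr_pdivrMr// /g; lra.
apply: (cvg_trans (near_eq_cvg _)); last first.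
  apply: (@expR_cvg0 (fun n => k%:R * ln n%:R + ln (m.+1%:R) - (p n)%:R / 2 * rate y)
    (ln (m.+1%:R)) g) => //.
  near=> n.
  have : 2 * (k%:R + g) / rate y * ln (n%:R : R) <= (p n)%:R.
    by near: n; exact: near_p_ge.
  rewrite mulrAC ler_pdivrMr//; lra.
near=> n; have n0 : (0 < n)%N by near: n; exact: nbhs_infty_gt.
rewrite -[in RHS](@lnK R (n ^ k * m.+1)%:R) ?posrE ?ltr0n ?muln_gt0 ?expn_gt0 ?n0//.
rewrite -expRD natrM natrX lnM ?posrE ?exprn_gt0 ?ltr0n// lnXn ?ltr0n//.
congr expR; rewrite -mulr_natl /rate; ring.
Unshelve. all: by end_near. Qed.

(** With rho = r / k, concavity of ln bounds the exponent of [overlap_bound] by rho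
    times its value for r = k, so all overlaps are controlled by the full one,
    for which the hypothesis on [l] is exactly what is needed. *)
Lemma overlap_cvg0 (k r : nat) (l delta : R) : (0 < r)%N -> (r <= k)%N ->
    1 < l -> 0 < delta -> rate l + delta * (l - 1) < 2 * k%:R / beta ->
  (k%:R / n%:R) ^+ r * overlap_bound (p n) k l delta r @[n --> \oo] --> 0.
Proof.
move=> r0 rk l1 d0 lk; have k0 : (0 < k)%N by exact: leq_trans rk.
have k1 : 0 < k%:R :> R by rewrite ltr0n.
set h := rate l + _ in lk.
have h0 : 0 < h by rewrite addr_gt0 ?rate_gt0// mulr_gt0// subr_gt0.
rewrite ltr_pdivlMr// in lk.
pose g := (k%:R - h * beta / 2) / 2.
have g0 : 0 < g by rewrite /g; lra.
have bb : beta < 2 * (k%:R - g) / h by rewrite ltr_pdivlMr// /g; lra.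
set rho : R := r%:R / k%:R.
have rho0 : 0 < rho by rewrite divr_gt0// ltr0n.
have rho1 : rho <= 1 by rewrite ler_pdivrMr// mul1r ler_nat.
have rE : r%:R = rho * k%:R by rewrite divfK// gt_eqF.
apply: (cvg_trans (near_eq_cvg _)); last first.
  apply: (@expR_cvg0 (fun n => r%:R * (ln k%:R - ln n%:R) + (p n)%:R / 2 *
    ((tilted_variance k l r - 1) * (1 + delta) - ln (tilted_variance k l r)))
    (r%:R * ln k%:R) (rho * g)).
    by rewrite mulr_gt0.
  near=> n.
  have : (p n)%:R <= 2 * (k%:R - g) / h * ln (n%:R : R).
    by near: n; exact: near_p_le.
  rewrite mulrAC ler_pdivlMr// => ph.
  have tv : (tilted_variance k l r - 1) * (1 + delta) - ln (tilted_variance k l r) <= rho * h.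
    have := ln_interpolation l1 (ltW rho0) rho1.
    rewrite /tilted_variance -/rho /h /rate; set L := ln (1 + _); lra.
  have : (p n)%:R / 2 * ((tilted_variance k l r - 1) * (1 + delta) -
      ln (tilted_variance k l r)) <= rho * ((k%:R - g) * ln n%:R).
    apply: (@le_trans _ _ ((p n)%:R / 2 * (rho * h))); first by rewrite ler_wpM2l.
    by rewrite mulrCA ler_pM2l//; lra.
  rewrite [in X in _ -> X]rE; set L := ln n%:R; set K := ln k%:R; set Z := _ / 2 * _.
  by move=> Zle; rewrite -subr_ge0; move: Zle; rewrite -subr_ge0; move=> Zle; lra.
near=> n; have n0 : (0 < n)%N by near: n; exact: nbhs_infty_gt.
rewrite /overlap_bound -[in RHS](@lnK R ((k%:R / n%:R) ^+ r)); last first.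
  by rewrite posrE exprn_gt0// divr_gt0// ltr0n.
rewrite -expRD lnXn ?divr_gt0 ?ltr0n// ln_div ?posrE ?ltr0n//.
by rewrite -[X in expR (X + _)]mulr_natl.
Unshelve. all: by end_near. Qed.

Lemma sum_cvg0 (m : nat) (c : nat -> R) (f : nat -> nat -> R) :
    (forall r, (r < m)%N -> f r n @[n --> \oo] --> 0) ->
  \sum_(r < m) c r * f r n @[n --> \oo] --> 0.
Proof.
elim: m => [_|m IH hf].
  by under eq_fun do rewrite big_ord0; exact: cvg_cst.
under eq_fun do rewrite big_ord_recr /=.
have h1 := IH (fun r rm => hf r (ltnW rm)).
have h2 : c m * f m n @[n --> \oo] --> c m * 0 by apply: cvgMl_tmp; exact: hf.
have : (\sum_(r < m) c r * f r n) + c m * f m n @[n --> \oo] --> 0 + c m * 0 by exact: cvgD.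
by rewrite mulr0 addr0.
Qed.

End asymptotics.

(** * Convergence in probability *)
Section main.
Context {R : realType} (k : nat) (beta : R) (p : nat -> nat).
Context (d : nat -> measure_display) (Omega : forall n, measurableType (d n)).
Context (P : forall n, probability (Omega n) R).
Context (X : forall n, 'I_(p n) * 'I_n -> {RV (P n) >-> R}).
Hypothesis k0 : (0 < k)%N.
Hypothesis beta0 : 0 < beta.
Hypothesis hp : (p n)%:R / ln (n%:R : R) @[n --> \oo] --> beta.
Hypothesis iidX : forall n, iid_with_law (@X n) (normal_prob 0 1).
Local Notation max_eigX n := (fun w => max_eig k (fun i => @X n i w)).

Lemma null_of_le (Q : nat -> \bar R) (B : nat -> R) :
    (forall n, (0 <= Q n)%E) -> (\forall n \near \oo, (Q n <= (B n)%:E)%E) ->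
    B n @[n --> \oo] --> 0 ->
  Q n @[n --> \oo] --> 0%E.
Proof.
move=> Q0 QB B0; apply: (@squeeze_cvge _ _ _ _ (fun=> 0%E) _ (fun n => (B n)%:E)).
- by apply: filterS QB => n ->; rewrite Q0.
- exact: cvg_cst.
- by apply: cvg_EFin; [exact: nearW|exact: B0].
Qed.

Lemma max_eig_upper_cvg0 (lambda eps : R) : 1 < lambda -> 0 < eps ->
    2 * k%:R / beta <= rate lambda ->
  P n [set w | (p n)%:R * (lambda + eps) < max_eigX n w] @[n --> \oo] --> 0%E.
Proof.
move=> l1 e0 hl; pose y := lambda + eps / 2; pose theta := eps / (8 * (lambda + eps)).
have le0 : 0 < lambda + eps by lra.
have th0 : 0 < theta by rewrite divr_gt0// mulr_gt0.
have th4 : theta <= 1 / 4 by rewrite ler_pdivrMr ?mulr_gt0//; lra.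
have [m m0 km] := grid_size k0 th0.
have y1 : 1 < y by rewrite /y; lra.
have hy : 2 * k%:R / beta < rate y.
  by apply: (le_lt_trans hl); apply: rate_lt; rewrite ?(ltW l1)// ltrDl divr_gt0.
apply: (null_of_le (fun=> measure_ge0 _ _) _ (upper_bound_cvg0 beta0 hp ((2 * m).+1 ^ k).-1 y1 hy)).
near=> n; have kn : (k <= n)%N by near: n; exact: nbhs_infty_ge.
rewrite prednK ?expn_gt0//; apply: (max_eig_upper_tail k0 kn (@iidX n) th0 th4 m0 km y1).
have -> : (1 - 4 * theta) * ((p n)%:R * (lambda + eps)) = y * (p n)%:R.
  by rewrite /theta /y; field; rewrite gt_eqF.
exact: lexx.
Unshelve. all: by end_near. Qed.

(** Choose l between 1 and lambda and close to lambda, then delta small: the strict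
    inequality rate l < 2 k / beta leaves room for delta. *)
Lemma max_eig_lower_cvg0 (lambda eps : R) : 1 < lambda -> 0 < eps ->
    rate lambda <= 2 * k%:R / beta ->
  P n [set w | max_eigX n w < (p n)%:R * (lambda - eps)] @[n --> \oo] --> 0%E.
Proof.
move=> lam1 e0 hlam.
pose l := Num.max ((1 + lambda) / 2) (lambda - eps / 2).
have l1 : 1 < l by rewrite lt_max; apply/orP; left; lra.
have ll : l < lambda by rewrite gt_max; apply/andP; split; lra.
have le : lambda - eps / 2 <= l by rewrite le_max lexx orbT.
have rl : rate l < 2 * k%:R / beta.
  by apply: lt_le_trans hlam; apply: rate_lt; rewrite ?(ltW l1).
pose d1 := (2 * k%:R / beta - rate l) / (2 * (l - 1)).
pose delta := Num.min (1 / 2) (Num.min (eps / (2 * l)) d1).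
have l0 : 0 < l by lra.
have dd : 0 < d1 by rewrite divr_gt0 ?mulr_gt0 ?subr_gt0.
have de0 : 0 < delta.
  by rewrite !lt_min dd andbT; apply/andP; split; [lra|rewrite divr_gt0// mulr_gt0].
have de1 : delta < 1.
  by apply: (@le_lt_trans _ _ (1 / 2)); [rewrite ge_min lexx|lra].
have de2 : l * delta <= eps / 2.
  have : delta <= eps / (2 * l) by rewrite !ge_min lexx !orbT.
  by rewrite ler_pdivlMr ?mulr_gt0//; lra.
have de3 : rate l + delta * (l - 1) < 2 * k%:R / beta.
  have : delta <= d1 by rewrite !ge_min lexx !orbT.
  rewrite ler_pdivlMr; last by rewrite mulr_gt0// subr_gt0.
  by move: rl; lra.
have c1 : 0 < delta - ln (1 + delta).
  have : ln (1 + delta) < 1 + delta - 1 by apply: ln_lt_sub1; [lra|rewrite gt_eqF//; lra].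
  by lra.
have c0 : 0 < - (delta + ln (1 - delta)).
  have : ln (1 - delta) < 1 - delta - 1 by apply: ln_lt_sub1; [lra|rewrite lt_eqF//; lra].
  by lra.
pose B n := 2 * (2 ^ k)%:R * expR (- ((p n)%:R / 2 * (delta - ln (1 + delta)))) +
    2 * expR (- ((p n)%:R / 2 * - (delta + ln (1 - delta)))) +
    \sum_(r < k) 'C(k, r.+1)%:R * ((k%:R / n%:R) ^+ r.+1 * overlap_bound (p n) k l delta r.+1).
apply: (null_of_le (B := B) (fun=> measure_ge0 _ _)).
- near=> n; have kn : (k <= n)%N by near: n; exact: nbhs_infty_ge.
  have mA := measurable_max_eig_lt (@X n) k0 kn.
  apply: (@le_trans _ _ (P n [set w | max_eigX n w < (p n)%:R * (l * (1 - delta))])).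
    apply: le_measure; rewrite ?inE; [exact: mA|exact: mA|move=> w /= h].
    by apply: (lt_le_trans h); rewrite ler_wpM2l//; lra.
  have := max_eig_lower_tail k0 kn (@iidX n) l1 de0 de1.
  by rewrite /B mulrN opprK.
- rewrite /B.
  have z1 : 2 * (2 ^ k)%:R * expR (- ((p n)%:R / 2 * (delta - ln (1 + delta)))) @[n --> \oo]
      --> 2 * (2 ^ k)%:R * (0 : R).
    by apply: cvgMl_tmp; exact: (expR_p_cvg0 beta0 hp c1).
  have z2 : 2 * expR (- ((p n)%:R / 2 * - (delta + ln (1 - delta)))) @[n --> \oo] --> 2 * (0 : R).
    by apply: cvgMl_tmp; exact: (expR_p_cvg0 beta0 hp c0).
  have z3 : \sum_(r < k) 'C(k, r.+1)%:R * ((k%:R / n%:R) ^+ r.+1 *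
      overlap_bound (p n) k l delta r.+1) @[n --> \oo] --> (0 : R).
    apply: (@sum_cvg0 _ k (fun r => 'C(k, r.+1)%:R)
      (fun r n => (k%:R / n%:R) ^+ r.+1 * overlap_bound (p n) k l delta r.+1)) => r rk.
    exact: (overlap_cvg0 beta0 hp (r := r.+1)).
  have := cvgD (cvgD z1 z2) z3; rewrite !mulr0 !addr0; exact.
Unshelve. all: by end_near. Qed.

Lemma max_eig_cvg_in_probability (lambda : R) : 1 < lambda -> rate lambda = 2 * k%:R / beta ->
  cvg_in_probability P (fun n w => max_eigX n w / (p n)%:R) lambda.
Proof.
move=> l1 hl eps e0; rewrite /=.
have U := @max_eig_upper_cvg0 lambda eps l1 e0; rewrite hl in U.
have L := @max_eig_lower_cvg0 lambda eps l1 e0; rewrite hl in L.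
have UL : (P n [set w | ((p n)%:R * (lambda + eps) < max_eigX n w)%R] +
    P n [set w | (max_eigX n w < (p n)%:R * (lambda - eps))%R])%E @[n --> \oo] --> 0%E.
  by rewrite -[X in _ --> X]adde0; apply: cvgeD; [|exact: U|exact: L].
apply: (@squeeze_cvge _ _ _ _ (fun=> 0%E) _ _ _ _ _ UL); last exact: cvg_cst.
near=> n; have kn : (k <= n)%N by near: n; exact: nbhs_infty_ge.
have pn : 0 < (p n)%:R :> R by rewrite ltr0n; near: n; exact: near_p_gt0 hp.
rewrite measure_ge0 /=.
have -> : [set w | eps < `|max_eigX n w / (p n)%:R - lambda|] =
   [set w | (p n)%:R * (lambda + eps) < max_eigX n w] `|`
   [set w | max_eigX n w < (p n)%:R * (lambda - eps)].
  apply/seteqP; split => w /=.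
    rewrite lter_normr => /orP[h|h]; [left|right].
      by rewrite mulrC -ltr_pdivlMr//; lra.
    by rewrite mulrC -ltr_pdivrMr//; lra.
  rewrite lter_normr => -[h|h]; apply/orP; [left|right].
    by rewrite mulrC -ltr_pdivlMr// in h; lra.
  by rewrite mulrC -ltr_pdivrMr// in h; lra.
apply: measureU2.
- exact: (measurable_max_eig_gt (@X n) k0 kn).
- exact: (measurable_max_eig_lt (@X n) k0 kn).
Unshelve. all: by end_near. Qed.

End main.

Theorem corollary1 (R : realType) (k : nat) (hk : (1 <= k)%N)
    (beta : R) (hbeta : 0 < beta)
    (p : nat -> nat)
    (hp : (p n)%:R / ln (n%:R : R) @[n --> \oo] --> beta)
    (d : nat -> measure_display)
    (Omega : forall n, measurableType (d n))
    (P : forall n, probability (Omega n) R)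
    (xi : forall n, 'I_(p n) -> 'I_n -> {RV (P n) >-> R})
    (hxi : forall n,
      iid_with_law (fun ij : 'I_(p n) * 'I_n => xi n ij.1 ij.2)
        (normal_prob 0 1)) :
  exists lambda : R,
    unique (fun l : R => 1 < l /\ l - ln l - 1 = 2 * k%:R / beta) lambda /\
    cvg_in_probability P
      (fun n w => max_gram_eigenvalue k (\matrix_(i, j) xi n i j w) / (p n)%:R)
      lambda.
Proof.
have v0 : 0 < 2 * k%:R / beta by rewrite divr_gt0// mulr_gt0// ltr0n.
have [lambda l1 hl] := rate_root v0.
exists lambda; split.
  split => // y [y1 hy]; have hy' : rate y = rate lambda by rewrite hl.
  have [h|h|//] := ltgtP lambda y.
  - by have := rate_lt (ltW l1) h; rewrite hy' ltxx.
  - by have := rate_lt (ltW y1) h; rewrite hy' ltxx.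
exact: (max_eig_cvg_in_probability hk hbeta hp hxi l1 hl).
Qed.
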